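(* Let $\Omega\subset\mathbb R^n$ be nonempty and open, let $f\in BV(\Omega)$, and write the Lebesgue decomposition of $Df$ with respect to $\mathcal L^n$ as $Df=f^a\,\mathcal L^n+D^sf$, where $f^a=(f^a_1,\dots,f^a_n)\in L^1(\Omega;\mathbb R^n)$ and $D^sf$ is singular with respect to $\mathcal L^n$. Let $1\le i\le n$ and let $g$ be any function equal to $f$ $\mathcal L^n$-almost everywhere for which the ordinary partial derivative $\partial g/\partial x_i$ exists $\mathcal L^n$-almost everywhere in $\Omega$. Then $\partial g/\partial x_i=f^a_i$ $\mathcal L^n$-almost everywhere in $\Omega$.
   Context: $BV(\Omega)$ is the set of $f\in L^1(\Omega)$ whose distributional partial derivatives $D_1f,\dots,D_nf$ are finite signed Radon measures on $\Omega$ of finite total variation; $Df=(D_1f,\dots,D_nf)$ is an $\mathbb R^n$-valued measure, $\mathcal L^n$ is Lebesgue measure. *)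

(* Defs.v *)
From HB Require Import structures.
From mathcomp Require Import all_boot all_order all_algebra.
From mathcomp Require Import all_classical all_reals all_analysis.
Set Implicit Arguments. Unset Strict Implicit. Unset Printing Implicit Defensive.
Import Order.TTheory GRing.Theory Num.Theory.
Import numFieldNormedType.Exports.
Local Open Scope classical_set_scope.
Local Open Scope ring_scope.

(* R^n is represented by row vectors 'rV[R]_n (with the product/matrix topology
   and norm).  Rn R n is the same carrier equipped with the Borel sigma-algebra,
   i.e. the sigma-algebra generated by the open sets of 'rV[R]_n. *)
Notation Rn R n := (g_sigma_algebraType (@open 'rV[R]_n)).

Definition evec (R : realType) (n : nat) (j : 'I_n) : 'rV[R]_n := delta_mx 0 j.

Definition box (R : realType) (n : nat) (a b : 'rV[R]_n) : set 'rV[R]_n :=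
  [set x | forall j : 'I_n, a 0 j < x 0 j <= b 0 j].

(* lam is (the restriction to Borel sets of) the n-dimensional Lebesgue
   measure: the unique measure on the Borel sets of R^n giving every box its
   volume. *)
Definition is_lebesgue_measure (R : realType) (n : nat)
    (lam : {measure set (Rn R n) -> \bar R}) : Prop :=
  forall a b : 'rV[R]_n, (forall j, a 0 j <= b 0 j) ->
    lam (box a b) = (\prod_(j < n) (b 0 j - a 0 j))%:E.

Definition partial (R : realType) (n : nat) (j : 'I_n)
    (phi : 'rV[R]_n -> R) : 'rV[R]_n -> R :=
  fun x => 'D_(evec R j) phi x.

Definition iter_partial (R : realType) (n : nat) (l : seq 'I_n)
    (phi : 'rV[R]_n -> R) : 'rV[R]_n -> R :=
  foldr (@partial R n) phi l.

Definition smooth (R : realType) (n : nat) (phi : 'rV[R]_n -> R) : Prop :=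
  forall l : seq 'I_n,
    continuous (iter_partial l phi) /\
    forall (j : 'I_n) (x : 'rV[R]_n), derivable (iter_partial l phi) x (evec R j).

Definition test_function (R : realType) (n : nat) (Omega : set 'rV[R]_n)
    (phi : 'rV[R]_n -> R) : Prop :=
  smooth phi /\
  compact (closure [set x | phi x != 0]) /\
  closure [set x | phi x != 0] `<=` Omega.

(* Main.v *)
(* Write [Df] for the [i]-th distributional derivative and let [w_h] be the
   difference quotient of [f] in direction [e_i]. For a Borel set [E], the integral
   of [w_h] over [E] is the integral against [Df] of the mean of [\1_E] over
   segments of length [h]. Since [f = g] almost everywhere, [w_h] tends to the
   partial derivative of [g] almost everywhere along a fixed sequence [h -> 0].
   If that limit exceeded [fa] on a set of positive measure, there would be [p < q]
   and a set [S] of positive measure, disjoint from the null set carrying the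
   singular part, on which [fa < p] while [w_h >= q] for all [h] in the sequence.
   Approximate [S] in measure by a set [F] built from half-open boxes and take
   [E = S `&` F]: as [h -> 0] the means of [\1_E] vanish off [F], so only the small
   mass of [F `\` S] is added to the at most [p * lam E] coming from [S], which
   contradicts the lower bound [q * lam E]. The reverse inequality is the same
   statement for [-f]. *)

Require Import Defs.
From HB Require Import structures.
From mathcomp Require Import all_boot all_order all_algebra.
From mathcomp Require Import all_classical all_reals all_analysis.
From mathcomp Require Import measurable_realfun ring lra.
Import Order.TTheory GRing.Theory Num.Theory.
Import numFieldNormedType.Exports.
Set Implicit Arguments.
Unset Strict Implicit.
Unset Printing Implicit Defensive.
Local Open Scope classical_set_scope.
Local Open Scope ring_scope.

(** * Smooth functions of one variable *)

(** The increments of [f] are handled through integrals over sets, never along single lines. The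
    singular part is the obstacle: it gives no mass to [S], but it may charge points arbitrarily
    close to [S], and the segments issuing from [S] run through them. Hence [F] must approximate [S]
    for one finite measure that dominates Lebesgue measure near [S] and also contains the positive
    singular part and the density [|fa - p|]. The negative singular part enters with a favourable
    sign, since averages are nonnegative. An approximate indicator is not the derivative of a
    compactly supported function, because its integral along lines is not 0; the indicator minus its
    translate by [h e_i] is. This is why difference quotients and averages over segments appear.
    Using only [h = 1 / (k + 1)] makes the exceptional sets countable intersections, hence
    measurable, and leaves only countably many translates of the null set where [g] may differ from
    [f]. *)

Definition flat (R : realType) (k : nat) (x : R) : R :=
  if 0 < x then x^-1 ^+ k * expR (- x^-1) else 0.

(* The closure properties are those that make the class stable under
   differentiation, so that its members are smooth. *)
Inductive smooth1 (R : realType) : (R -> R) -> Prop :=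
| smooth1_flat k : smooth1 (@flat R k)
| smooth1_cst c : smooth1 (fun=> c)
| smooth1_id : smooth1 id
| smooth1D r s : smooth1 r -> smooth1 s -> smooth1 (fun x => r x + s x)
| smooth1M r s : smooth1 r -> smooth1 s -> smooth1 (fun x => r x * s x)
| smooth1V r : (forall x, r x != 0) -> smooth1 r -> smooth1 (fun x => (r x)^-1)
| smooth1_affine a c r : smooth1 r -> smooth1 (fun x => r (a * x + c)).

(** From [z <= 1 + z <= expR z] at [z = y / (m + 1)], raised to the power [m + 1]. *)
Lemma exp_le_expR (R : realType) (m : nat) (y : R) :
  0 <= y -> y ^+ m.+1 <= m.+1%:R ^+ m.+1 * expR y.
Proof.
move=> y0; have m0 : 0 < m.+1%:R :> R by rewrite ltr0n.
have -> : expR y = expR (y / m.+1%:R) ^+ m.+1.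
  by rewrite -expRM_natl mulrCA mulfV ?mulr1// gt_eqF.
rewrite -exprMn ler_pXn2r// ?nnegrE ?mulr_ge0// ?expR_ge0//.
rewrite mulrC -ler_pdivrMr//; apply: le_trans (expR_ge1Dx _).
by rewrite lerDr.
Qed.

(** This is [exp_le_expR] at [y = 1 / x]. The bound is linear in [x] so that it yields the limit 0
    needed for the derivative at the origin. *)
Lemma flat_bound (R : realType) (k : nat) :
  exists2 C : R, 0 < C & forall x : R, `|flat k x| <= C * `|x|.
Proof.
exists (k.+1%:R ^+ k.+1); first by rewrite exprn_gt0// ltr0n.
move=> x; rewrite /flat; case: ifPn => [x0|_]; last first.
  by rewrite normr0 mulr_ge0// exprn_ge0.
have y0 : 0 <= x^-1 by rewrite invr_ge0 ltW.
rewrite ger0_norm ?mulr_ge0 ?exprn_ge0 ?expR_ge0// gtr0_norm// expRN.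
rewrite -ler_pdivlMr ?invr_gt0 ?expR_gt0// invrK.
rewrite -(ler_pM2r (x := x^-1)) ?invr_gt0// -exprSr.
by rewrite mulrAC -(mulrA _ x) mulfV ?gt_eqF// mulr1 exp_le_expR.
Qed.

(** The powers of [1 / x] are carried along so that differentiation stays within linear combinations
    of the family. *)
Lemma is_derive_flat (R : realType) (k : nat) (x : R) :
  is_derive x 1 (@flat R k) (flat k.+2 x - k%:R * flat k.+1 x).
Proof.
have [x0|x0|->] := ltrgtP x 0.
- have -> : flat k.+2 x - k%:R * flat k.+1 x = 0.
    by rewrite /flat ltNge ltW//= mulr0 subr0.
  apply: (@near_eq_is_derive R R^o R^o (cst 0)).
  by near=> y; rewrite /flat ltNge ltW//=; near: y; exact: lt_nbhsl.
- have dx : is_derive x 1 (fun y : R => y^-1 ^+ k * expR (- y^-1))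
     (flat k.+2 x - k%:R * flat k.+1 x).
    have xn0 : x != 0 by rewrite gt_eqF.
    have dV : is_derive x 1 (fun y : R => y^-1) (- x ^- 2).
      by have := is_deriveV xn0 (is_derive_id x (1:R)); rewrite /GRing.scale/= mulr1.
    have dN : is_derive x 1 (fun y : R => - y^-1) (x ^- 2).
      by have := is_deriveN dV; rewrite opprK.
    have dE := @is_derive1_comp R expR (fun y => - y^-1) x _ _ (is_derive_expR (- x^-1)) dN.
    have := is_deriveM (is_deriveX k dV) dE.
    rewrite /flat x0 /GRing.scale/=.
    rewrite (_ : _ * _ = (fun y : R => y^-1 ^+ k * expR (- y^-1))); last first.
      by apply/funext => y; rewrite /= !fctE.
    move=> /is_derive_eq; apply; rewrite !fctE.
    case: k => [|k]; first by rewrite !expr0 !mul0r mulr0 expr2; field.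
    rewrite -[k.+1.-1]/k !exprS.
    by field.
  apply: near_eq_is_derive dx.
  near=> y; rewrite /flat ifT//; near: y; exact: lt_nbhsr.
(* At 0 the difference quotient of [flat k] is [flat k.+1] itself, which tends to 0 by the linear
   bound. *)
- have [C C0 HC] := flat_bound R k.+1.
  have -> : flat k.+2 0 - k%:R * flat k.+1 0 = 0 :> R.
    by rewrite /flat ltxx mulr0 subr0.
  have cv : (fun h : R => h^-1 *: ((@flat R k \o shift 0) (h *: 1) - flat k 0)) @ 0^' --> (0 : R).
    rewrite (_ : (fun _ => _) = @flat R k.+1).
      apply/cvgr0Pnorm_le => e e0; near=> y.
      apply: le_trans (HC y) _; rewrite mulrC -ler_pdivlMr//.
      near: y; apply: dnbhs0_le; exact: divr_gt0.
    apply/funext => y; rewrite /= addr0 /flat ltxx subr0 /GRing.scale/= mulr1.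
    by case: ifPn => _; rewrite ?mulr0// exprS mulrA.
  apply: DeriveDef; first by apply/cvg_ex; exists 0.
  exact: cvg_lim.
Unshelve. all: by end_near. Qed.

Lemma is_derive_affine (R : realType) (a c x : R) (f : R -> R) (df : R) :
  is_derive (a * x + c) 1 f df ->
  is_derive x 1 (fun y => f (a * y + c)) (a * df).
Proof.
move=> fd.
have ad : is_derive x 1 (fun y : R => a * y + c) a.
  have -> : (fun y : R => a * y + c) = a \*: id + cst c by apply/funext.
  by apply: is_derive_eq; rewrite addr0 /GRing.scale/= mulr1.
have := @is_derive1_comp R f _ x df a fd ad.
by rewrite mulrC.
Qed.

Lemma smooth1_derive (R : realType) (r : R -> R) : smooth1 r ->
  exists2 r', smooth1 r' & forall x, is_derive x (1:R) r (r' x).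
Proof.
elim=> {r} [k|c||r s _ [r' sr' dr] _ [s' ss' ds]|r s sr [r' sr' dr] ss [s' ss' ds]
  |r r0 sr [r' sr' dr]|a c r _ [r' sr' dr]].
- exists (fun x => flat k.+2 x + (- k%:R) * flat k.+1 x).
    apply: smooth1D; first exact: smooth1_flat.
    by apply: smooth1M; [exact: smooth1_cst|exact: smooth1_flat].
  by move=> x; rewrite mulNr; exact: is_derive_flat.
- by exists (fun=> 0); [exact: smooth1_cst|move=> x; exact: is_derive_cst].
- by exists (fun=> 1); [exact: smooth1_cst|move=> x; exact: is_derive_id].
- exists (fun x => r' x + s' x); first exact: smooth1D.
  by move=> x; have := dr x; have := ds x => ? ?; exact: is_deriveD.
- exists (fun x => r x * s' x + s x * r' x).
    by apply: smooth1D; exact: smooth1M.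
  by move=> x; have := dr x; have := ds x => ? ?; exact: is_deriveM.
- exists (fun x => - 1 * ((r x)^-1 * (r x)^-1 * r' x)).
    apply: smooth1M; first exact: smooth1_cst.
    by do 2?apply: smooth1M => //; exact: smooth1V.
  move=> x; have /is_derive_eq := is_deriveV (r0 x) (dr x); apply.
  by rewrite /GRing.scale/= -expr2 exprVn mulN1r mulNr.
- exists (fun x => a * r' (a * x + c)).
    by apply: smooth1M; [exact: smooth1_cst|exact: smooth1_affine].
  by move=> x; exact: is_derive_affine.
Qed.

Lemma smooth1_continuous (R : realType) (r : R -> R) : smooth1 r -> continuous r.
Proof.
move=> /smooth1_derive[r' _ dr] x.
by apply/differentiable_continuous/derivable1_diffP; have [] := dr x.
Qed.

Lemma derive_near_eq0 (R : realType) (r : R -> R) (x c dr : R) :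
  (\forall y \near x, r y = c) -> is_derive x (1:R) r dr -> dr = 0.
Proof.
move=> rc rd; have cd : is_derive x 1 r 0.
  apply: (@near_eq_is_derive R R^o R^o (cst c)).
  by near=> y; rewrite /=; symmetry; near: y.
by have [_ <-] := rd; have [_ ->] := cd.
Unshelve. all: by end_near. Qed.

Lemma smooth_step (R : realType) : exists2 th : R -> R, smooth1 th &
  [/\ forall x : R, x <= 0 -> th x = 0, forall x, 1 <= x -> th x = 1 &
      forall x, 0 <= th x <= 1].
Proof.
(* The step is [e x / (e x + e (1 - x))]. Here [e'] is the reflection of [e], not a derivative; the
   denominator is positive because [x] or [1 - x] is. *)
pose e := @flat R 0; pose e' (x : R) := e (-1 * x + 1).
have e_ge0 x : 0 <= e x.
  by rewrite /e /flat; case: ifP => // _; rewrite mulr_ge0 ?expr0 ?expR_ge0.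
have e_gt0 (x : R) : 0 < x -> 0 < e x.
  by move=> x0; rewrite /e /flat x0 expr0 mul1r expR_gt0.
have e_le0 (x : R) : x <= 0 -> e x = 0 by rewrite leNgt /e /flat => /negbTE ->.
have d0 (x : R) : 0 < e x + e' x.
  have [x0|x0] := ltP 0 x.
    by apply: ltr_pwDl; [exact: e_gt0|exact: e_ge0].
  by apply: ltr_wpDl; [exact: e_ge0|apply: e_gt0; lra].
exists (fun x => e x * (e x + e' x)^-1).
  apply: smooth1M; first exact: smooth1_flat.
  apply: smooth1V => [x|]; first by rewrite gt_eqF.
  by apply: smooth1D; [|apply: smooth1_affine]; exact: smooth1_flat.
split=> x.
- by move=> /e_le0 ->; rewrite mul0r.
- move=> x1; have -> : e' x = 0 by rewrite /e' e_le0//; lra.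
  by rewrite addr0 mulfV// gt_eqF// e_gt0//; lra.
- by rewrite divr_ge0 ?e_ge0 ?(ltW (d0 x))//= ler_pdivrMr ?d0// mul1r lerDl e_ge0.
Qed.

(* [S = x * step x] is an explicit antiderivative of a smooth step [s] that
   need not take its values in [0, 1]. *)
Lemma smooth_ramp (R : realType) : exists S s : R -> R,
  [/\ smooth1 S, smooth1 s, forall x, is_derive x (1:R) S (s x),
    [/\ forall x : R, x <= 0 -> S x = 0, forall x : R, 1 <= x -> S x = x &
      forall x, `|S x - Num.max x 0| <= 1] &
    [/\ forall x : R, x <= 0 -> s x = 0, forall x : R, 1 < x -> s x = 1 &
      exists M : R, forall x, `|s x| <= M]].
Proof.
have [th sth [th0 th1 th01]] := smooth_step R.
have [th' sth' dth] := smooth1_derive sth.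
have th'0 (x : R) : x < 0 -> th' x = 0.
  move=> x0; apply: derive_near_eq0 (dth x).
  by apply: filterS (lt_nbhsl x0) => y /ltW; exact: th0.
have th'1 (x : R) : 1 < x -> th' x = 0.
  move=> x1; apply: derive_near_eq0 (dth x).
  by apply: filterS (lt_nbhsr x1) => y /ltW; exact: th1.
exists (fun x => x * th x), (fun x => x * th' x + th x); split.
- by apply: smooth1M => //; exact: smooth1_id.
- by apply: smooth1D => //; apply: smooth1M => //; exact: smooth1_id.
- move=> x; have := is_deriveM (is_derive_id x (1:R)) (dth x).
  by rewrite /GRing.scale/= mulr1.
- split=> [x x0|x x1|x]; [by rewrite th0// mulr0|by rewrite th1// mulr1|].
  have [x0|x0] := leP x 0; first by rewrite th0// mulr0 subrr normr0.
  have [x1|x1] := leP 1 x; first by rewrite th1// mulr1 subrr normr0.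
  have /andP[t0 t1] := th01 x.
  by rewrite ler_norml; apply/andP; split; nra.
- split=> [x|x x1|].
    rewrite le_eqVlt => /orP[/eqP->|x0]; first by rewrite mul0r th0// addr0.
    by rewrite th'0// th0 ?ltW// mulr0 addr0.
    by rewrite th'1// th1 ?mulr0 ?add0r// ltW.
  (* [th'] vanishes outside [[0, 1]], so a maximum on this compact interval bounds [x * th' x]
     everywhere. *)
  have cth : {within `[0, 1], continuous (fun x : R => `|th' x|)}.
    by apply: continuous_subspaceT => x; apply: cvg_norm; exact: smooth1_continuous.
  have [c _ hc] := EVT_max ler01 cth.
  exists (`|th' c| + 1) => x.
  apply: le_trans (ler_normD _ _) _; apply: lerD; last first.
    by have /andP[t0 t1] := th01 x; rewrite ger0_norm.
  rewrite normrM; have [x0|x0] := ltP x 0.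
    by rewrite th'0// normr0 mulr0.
  have [x1|x1] := leP x 1; last by rewrite th'1// normr0 mulr0.
  have h := hc x; rewrite in_itv/= x0 x1 in h.
  by rewrite (ger0_norm x0) -[leRHS]mul1r ler_pM// h.
Unshelve. all: by end_near. Qed.

(** * Test functions approximating boxes *)

Lemma smooth1B (R : realType) (r s : R -> R) :
  smooth1 r -> smooth1 s -> smooth1 (fun x => r x - s x).
Proof.
move=> sr ss; rewrite (_ : (fun x => _) = fun x => r x + -1 * s x).
  by apply: smooth1D => //; apply: smooth1M => //; exact: smooth1_cst.
by apply/funext => x; rewrite mulN1r.
Qed.

Lemma cvg_prodr (R : realType) (T I : Type) (F : set_system T) {FF : Filter F}
    (s : seq I) (P : pred I) (u : I -> T -> R) (l : I -> R) :
  (forall j, u j t @[t --> F] --> l j) ->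
  \prod_(j <- s | P j) u j t @[t --> F] --> \prod_(j <- s | P j) l j.
Proof.
move=> ul; elim: s => [|j s ih].
  rewrite big_nil (_ : (fun t => _) = cst (1 : R)); first exact: cvg_cst.
  by apply/funext => t; rewrite big_nil.
rewrite big_cons.
rewrite (_ : (fun t => _) = fun t =>
  if P j then u j t * \prod_(j <- s | P j) u j t else \prod_(j <- s | P j) u j t).
  by case: ifP => _ //; exact: cvgM.
by apply/funext => t; rewrite big_cons.
Qed.

Definition prodf (R : realType) (n : nat) (r : 'I_n -> R -> R) (x : 'rV[R]_n) : R :=
  \prod_(j < n) r j (x 0 j).

Lemma is_derive_prodf (R : realType) (n : nat) (r : 'I_n -> R -> R)
    (x : 'rV[R]_n) (j : 'I_n) (d : R) :
  is_derive (x 0 j) (1 : R) (r j) d ->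
  is_derive x (evec R j) (prodf r) (d * \prod_(l < n | l != j) r l (x 0 l)).
Proof.
move=> [dr dE]; set c := \prod_(l < n | l != j) _.
have cv : (fun h : R => h^-1 *: ((prodf r \o shift x) (h *: evec R j) - prodf r x))
    @ 0^' --> d * c.
  rewrite (_ : (fun h => _) = fun h : R =>
    h^-1 *: ((r j \o shift (x 0 j)) (h *: 1) - r j (x 0 j)) * c).
    apply: cvgM; last exact: cvg_cst.
    by rewrite -dE; exact: dr.
  apply/funext => h; rewrite /= /prodf (bigD1 j)//= [X in _ - X](bigD1 j)//=.
  rewrite (eq_bigr (fun l => r l (x 0 l))) => [|l lj]; last first.
    by rewrite !mxE eqxx (negbTE lj) mulr0 add0r.
  by rewrite !mxE !eqxx /GRing.scale/= -/c -mulrBl mulrA.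
apply: DeriveDef; first by apply/cvg_ex; exists (d * c).
exact: cvg_lim.
Qed.

Lemma partial_prodf (R : realType) (n : nat) (r : 'I_n -> R -> R) (j : 'I_n)
    (d : R -> R) : (forall y, is_derive y (1 : R) (r j) (d y)) ->
  partial j (prodf r) = prodf (fun l => if l == j then d else r l).
Proof.
move=> dr; apply/funext => x; have [_ xE] := is_derive_prodf (dr (x 0 j)).
rewrite /partial xE /prodf [RHS](bigD1 j)//= eqxx; congr (_ * _).
by apply: eq_bigr => l /negbTE ->.
Qed.

(** A partial derivative changes a single factor into its derivative, so iterated derivatives remain
    products and smoothness reduces to one variable. *)
Lemma iter_partial_prodf (R : realType) (n : nat) (r : 'I_n -> R -> R) (l : seq 'I_n) :
  (forall j, smooth1 (r j)) ->
  exists2 r', (forall j, smooth1 (r' j)) & iter_partial l (prodf r) = prodf r'.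
Proof.
move=> sr; elim: l => [|j l [r' sr' E]]; first by exists r.
have [d sd dd] := smooth1_derive (sr' j).
exists (fun l => if l == j then d else r' l) => [k|]; first by case: ifP.
by rewrite /iter_partial/= -/(iter_partial l _) E; exact: partial_prodf.
Qed.

Lemma continuous_prodf (R : realType) (n : nat) (r : 'I_n -> R -> R) :
  (forall j, smooth1 (r j)) -> continuous (prodf r).
Proof.
move=> sr x; apply: (@cvg_prodr R _ _ (nbhs x) (nbhs_filter x)) => j.
by apply: continuous_comp; [exact: coord_continuous|exact: smooth1_continuous].
Qed.

Lemma smooth_prodf (R : realType) (n : nat) (r : 'I_n -> R -> R) :
  (forall j, smooth1 (r j)) -> smooth (prodf r).
Proof.
move=> sr l; have [r' sr' ->] := iter_partial_prodf l sr.
split=> [|j x]; first exact: continuous_prodf.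
have [d _ dd] := smooth1_derive (sr' j).
by have [] := is_derive_prodf (dd (x 0 j)).
Qed.

Lemma test_function_prodf (R : realType) (n : nat) (r : 'I_n -> R -> R)
    (c d : 'rV[R]_n) (Omega : set 'rV[R]_n) :
  (forall j, smooth1 (r j)) ->
  (forall j y, r j y != 0 -> c 0 j <= y <= d 0 j) ->
  [set x : 'rV[R]_n | forall j, c 0 j <= x 0 j <= d 0 j] `<=` Omega ->
  test_function Omega (prodf r).
Proof.
move=> sr rcd cdO; split; first exact: smooth_prodf.
pose B := [set x : 'rV[R]_n | forall j, `[c 0 j, d 0 j]%classic (x 0 j)].
have cB : compact B by apply: (@rV_compact R n (fun j => `[c 0 j, d 0 j]%classic)) => j; exact: segment_compact.
have BO : B `<=` Omega.
  by move=> x Bx; apply: cdO => j; have := Bx j; rewrite /= in_itv.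
have subB : closure [set x | prodf r x != 0] `<=` B.
  have clB : closed B by apply: compact_closed => //; exact: norm_hausdorff.
  rewrite [X in _ `<=` X]((closure_id B).1 clB); apply: closure_subset => x /= rx j.
  rewrite /= in_itv/=; apply: rcd; apply: contra rx => /eqP rx.
  by rewrite /prodf (bigD1 j)//= rx mul0r.
split; last exact: subset_trans BO.
by apply: subclosed_compact cB _ => //; exact: closed_closure.
Qed.

(** For [a <= b] and [0 <= h] this is the convolution of the indicators of []a, b]] and [[0, h[].
    The form with ramps shows it as [P y - P (y - h)], with [P] an antiderivative of the first
    indicator. *)
Definition tent (R : realType) (h a b y : R) : R :=
  Num.max (y - a) 0 - Num.max (y - b) 0 -
  (Num.max (y - h - a) 0 - Num.max (y - h - b) 0).

(** [psi] is a product of smoothed interval indicators. In [phi] the [i]-th factor is replaced by an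
    antiderivative minus its translate by [h], which restores compact support. The uniform bound [M]
    serves dominated convergence. *)
Lemma box_test_functions (R : realType) (n : nat) (i : 'I_n) (h r : R)
    (a b : 'rV[R]_n) (Omega : set 'rV[R]_n) :
  (forall j, a 0 j <= b 0 j) -> 0 < h -> h < r ->
  [set x : 'rV[R]_n | forall j, a 0 j <= x 0 j <= b 0 j + r] `<=` Omega ->
  exists (psi phi : nat -> 'rV[R]_n -> R) (M : R),
  [/\ forall k, test_function Omega (phi k),
      forall k x, partial i (phi k) x = psi k x - psi k (x - h *: evec R i),
      forall k, continuous (psi k) /\ continuous (phi k),
      forall k x, `|psi k x| <= M /\ `|phi k x| <= M &
      forall x, psi k x @[k --> \oo] --> (\1_(box a b) x : R) /\
       phi k x @[k --> \oo] --> tent h (a 0 i) (b 0 i) (x 0 i) *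
         \prod_(j < n | j != i) ((a 0 j < x 0 j <= b 0 j)%R%:R : R)].
Proof.
move=> ab h0 hr abO.
have [S [s [sS ss dS [S0 S1 Smax] [s0 s1 [M sM]]]]] := smooth_ramp R.
(* The transitions of [s (K k * _)] have width [1 / K k]. The term [(r - h)^-1] keeps this width at
   most [r - h], so that after the shift by [h] the supports still end before [b + r]. *)
pose K (k : nat) : R := k%:R + 1 + (r - h)^-1.
have rh2 : 0 < r - h by rewrite subr_gt0.
have rh0 : 0 < (r - h)^-1 by rewrite invr_gt0.
have K0 k : 0 < K k by rewrite /K ltr_wpDl// ?addr_ge0.
have Kr k : 1 <= K k * (r - h).
  by rewrite /K mulrDl mulVf ?gt_eqF// lerDr mulr_ge0 ?(ltW rh2)// addr_ge0.
have KN k : k%:R <= K k by rewrite /K -addrA lerDl addr_ge0// ltW.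
(* Both transitions start exactly at an endpoint and go to the right, so the pointwise limit is the
   indicator of the half-open interval []a, b]]. *)
pose bump k a b (y : R) := s (K k * y + - (K k * a)) - s (K k * y + - (K k * b)).
pose P k a b (y : R) := (K k)^-1 * (S (K k * y + - (K k * a)) - S (K k * y + - (K k * b))).
pose q k a b (y : R) := P k a b y - P k a b (1 * y + - h).
have sbump k a' b' : smooth1 (bump k a' b') by apply: smooth1B; exact: smooth1_affine.
have sP k a' b' : smooth1 (P k a' b').
  by apply: smooth1M; [exact: smooth1_cst|apply: smooth1B; exact: smooth1_affine].
have sq k a' b' : smooth1 (q k a' b') by apply: smooth1B => //; exact: smooth1_affine.
have dP k a' b' y : is_derive y (1 : R) (P k a' b') (bump k a' b' y).
  have /is_derive_eq := is_deriveM (is_derive_cst ((K k)^-1) y (1:R))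
    (is_deriveB (is_derive_affine (dS (K k * y + - (K k * a'))))
                (is_derive_affine (dS (K k * y + - (K k * b'))))).
  apply; rewrite /GRing.scale/= mulr0 addr0 -mulrBr mulrA mulVf ?mul1r//.
  by rewrite gt_eqF.
have dq k a' b' y : is_derive y (1 : R) (q k a' b') (bump k a' b' y - bump k a' b' (y - h)).
  have /is_derive_eq := is_deriveB (dP k a' b' y) (is_derive_affine (dP k a' b' (1 * y + - h))).
  by apply; rewrite !mul1r.
have bumpM k a' b' y : `|bump k a' b' y| <= M + M.
  by apply: le_trans (ler_normB _ _) _; exact: lerD.
have scvg a' (y : R) : s (K k * y + - (K k * a')) @[k --> \oo] --> ((a' < y)%R%:R : R).
  apply: cvg_near_cst.
  have [ya|ya] := ltP a' y; last first.
    by apply: nearW => k /=; rewrite -mulrBr s0// mulr_ge0_le0 ?(ltW (K0 k))// subr_le0.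
  near=> k; rewrite /= -mulrBr s1//.
  have ya0 : 0 < y - a' by rewrite subr_gt0.
  apply: (@lt_le_trans _ _ (k%:R * (y - a'))); last by rewrite ler_pM2r.
  by rewrite -ltr_pdivrMr// div1r; near: k; exact: nbhs_infty_gtr.
have bcvg a' b' (y : R) : a' <= b' ->
    bump k a' b' y @[k --> \oo] --> ((a' < y <= b')%R%:R : R).
  move=> ab'; rewrite (_ : _%:R = (a' < y)%R%:R - (b' < y)%R%:R); last first.
    have [yb|yb] := leP y b'; first by rewrite andbT subr0.
    by rewrite andbF (le_lt_trans ab' yb) subrr.
  by apply: cvgB; exact: scvg.
have Kinv : (K k)^-1 @[k --> \oo] --> (0 : R).
  apply/cvgr0Pnorm_le => e e0; near=> k.
  rewrite gtr0_norm ?invr_gt0// -[leRHS]invrK lef_pV2 ?posrE ?invr_gt0//.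
  apply: le_trans (KN k); near: k; exact: nbhs_infty_ger.
(* Rescaling turns the distance 1 between [S] and the positive part into [1 / K k]; this gives both
   the convergence and the uniform bound of [P]. *)
have Sq a' k y : `|(K k)^-1 * S (K k * y + - (K k * a')) - Num.max (y - a') 0| <= (K k)^-1.
  rewrite -mulrBr; have := Smax (K k * (y - a')).
  have -> : Num.max (K k * (y - a')) 0 = K k * Num.max (y - a') 0.
    by rewrite maxr_pMr ?ltW// mulr0.
  rewrite -(ler_pM2l (x := (K k)^-1)) ?invr_gt0// mulr1.
  apply: le_trans; rewrite -{2}(gtr0_norm (x := (K k)^-1)) ?invr_gt0//.
  by rewrite -normrM [X in _ <= `|X|]mulrBr mulKf// gt_eqF.
have Scvg a' y : (K k)^-1 * S (K k * y + - (K k * a')) @[k --> \oo] --> Num.max (y - a') 0.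
  apply/cvgrPdist_le => e e0; near=> k.
  rewrite distrC; apply: le_trans (Sq a' k y) _.
  rewrite -[leLHS]gtr0_norm ?invr_gt0//; near: k.
  by move/cvgr0Pnorm_le : Kinv; apply.
have qcvg a' b' y : q k a' b' y @[k --> \oo] --> tent h a' b' y.
  rewrite /q /P /tent !mul1r; apply: cvgB.
    by under eq_fun do rewrite mulrBr; apply: cvgB; exact: Scvg.
  by under eq_fun do rewrite mulrBr; apply: cvgB; exact: Scvg.
have PM k a' b' y : a' <= b' -> `|P k a' b' y| <= b' - a' + ((r - h) + (r - h)).
  move=> ab'; have K1 : (K k)^-1 <= r - h.
    by rewrite invf_ple ?posrE ?subr_gt0// /K lerDr addr_ge0.
  have := le_trans (Sq a' k y) K1; have := le_trans (Sq b' k y) K1.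
  rewrite /P mulrBr !ler_norml => /andP[? ?] /andP[? ?].
  have /andP[? ?] : 0 <= Num.max (y - a') 0 - Num.max (y - b') 0 <= b' - a'.
    by case: (leP (y - a') 0) => ?; case: (leP (y - b') 0) => ?; apply/andP; split; lra.
  by apply/andP; split; lra.
pose psi k := prodf (fun j => bump k (a 0 j) (b 0 j)).
pose phi k := prodf (fun j =>
  if j == i then q k (a 0 i) (b 0 i) else bump k (a 0 j) (b 0 j)).
have sphi k j : smooth1 (if j == i then q k (a 0 i) (b 0 i) else bump k (a 0 j) (b 0 j)).
  by case: ifP.
pose C := 1 + (M + M) + ((b 0 i - a 0 i + ((r - h) + (r - h))) + (b 0 i - a 0 i + ((r - h) + (r - h)))).
have M0 : 0 <= M by apply: le_trans (sM 0).
have rh1 : 0 <= r - h by rewrite subr_ge0 ltW.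
have abi : 0 <= b 0 i - a 0 i by rewrite subr_ge0.
have prodM (f : 'I_n -> R) : (forall j, `|f j| <= C) -> `|\prod_j f j| <= C ^+ n.
  move=> fC; rewrite normr_prod; apply: (@le_trans _ _ (\prod_(j < n) C)).
    by apply: ler_prod => j _; rewrite normr_ge0 fC.
  by rewrite prodr_const card_ord.
exists psi, phi, (C ^+ n); split.
- move=> k; apply: (@test_function_prodf _ _ _ a (b + const_mx r)) => // [j y|]; last first.
    by move=> x xab; apply: abO => j; have := xab j; rewrite !mxE.
  have Kbr : 1 <= K k * (r - h) by [].
  rewrite !mxE; apply: contraR; rewrite negb_and -!ltNge => /orP[ya|yb].
    have yb : y <= b 0 j by apply: le_trans (ltW ya) (ab j).
    have Ky (z t : R) : y <= z -> 0 <= t -> S (K k * (y - t) + - (K k * z)) = 0 /\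
        s (K k * (y - t) + - (K k * z)) = 0.
      move=> yz t0; have H : K k * (y - t) + - (K k * z) <= 0.
        by rewrite -mulrBr; apply: mulr_ge0_le0; [exact: ltW|lra].
      by split; [exact: S0|exact: s0].
    have [Sa sa] := Ky _ _ (ltW ya) (lexx 0); have [Sb sb] := Ky _ _ yb (lexx 0).
    have [Sah _] := Ky _ _ (ltW ya) (ltW h0); have [Sbh _] := Ky _ _ yb (ltW h0).
    rewrite subr0 in Sa sa; rewrite subr0 in Sb sb.
    case: ifP => [/eqP ji|_]; last by rewrite /bump sa sb subrr.
    by rewrite /q /P !mul1r -ji Sa Sb Sah Sbh subrr.
  (* To the right of [b + r] all ramps are in their linear regime, so [P] takes the same value at
     [y] and at [y - h], and [q] vanishes. *)
  have Ky (z t : R) : z <= b 0 j -> t <= h ->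
      S (K k * (y - t) + - (K k * z)) = K k * (y - t) + - (K k * z) /\
      s (K k * (y - t) + - (K k * z)) = 1.
    move=> zb th; have H : 1 < K k * (y - t) + - (K k * z).
      by rewrite -mulrBr; apply: le_lt_trans Kbr _; rewrite ltr_pM2l//; lra.
    by split; [exact/S1/ltW|exact: s1].
  have [Sa sa] := Ky _ 0 (ab j) (ltW h0); have [Sb sb] := Ky _ 0 (lexx _) (ltW h0).
  have [Sah _] := Ky _ _ (ab j) (lexx _); have [Sbh _] := Ky _ _ (lexx _) (lexx h).
  rewrite subr0 in Sa sa; rewrite subr0 in Sb sb.
  case: ifP => [/eqP ji|_]; last by rewrite /bump sa sb subrr.
  by rewrite /q /P !mul1r -ji Sa Sb Sah Sbh; apply/eqP; ring.
- move=> k x; pose d y := bump k (a 0 i) (b 0 i) y - bump k (a 0 i) (b 0 i) (y - h).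
  have -> : partial i (phi k) = prodf (fun l => if l == i then d else
      if l == i then q k (a 0 i) (b 0 i) else bump k (a 0 l) (b 0 l)).
    by apply: partial_prodf => y; rewrite eqxx; exact: dq.
  rewrite /psi /prodf (bigD1 i)//= eqxx [X in _ = X - _](bigD1 i)//= [X in _ = _ - X](bigD1 i)//=.
  rewrite mulrBl !mxE !eqxx mulr1; congr (_ * _ - _ * _).
    by apply: eq_bigr => j /negbTE ->.
  by apply: eq_bigr => j ji; rewrite !mxE eqxx (negbTE ji) mulr0 subr0.
- by move=> k; split; exact: continuous_prodf.
- move=> k x; split; apply: prodM => j.
    by apply: le_trans (bumpM _ _ _ _) _; rewrite /C; lra.
  case: ifP => _; last by apply: le_trans (bumpM _ _ _ _) _; rewrite /C; lra.
  apply: (@le_trans _ _ ((b 0 i - a 0 i + ((r - h) + (r - h))) + (b 0 i - a 0 i + ((r - h) + (r - h))))).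
    by apply: le_trans (ler_normB _ _) _; apply: lerD; exact: PM.
  by rewrite /C; lra.
- move=> x; split.
    rewrite (_ : \1_(box a b) x = \prod_j ((a 0 j < x 0 j <= b 0 j)%R%:R : R)).
      by apply: cvg_prodr => j; exact: bcvg.
    rewrite indicE; have [xab|] := boolP (x \in _).
      by rewrite big1// => j _; move: xab; rewrite inE => /(_ j) ->.
    rewrite notin_setE => /existsNP[j /negP/negbTE xj].
    by rewrite (bigD1 j)//= xj mul0r.
  rewrite (_ : _ * _ = \prod_(j < n) (if j == i then tent h (a 0 i) (b 0 i) (x 0 i)
     else (a 0 j < x 0 j <= b 0 j)%R%:R)); last first.
    by rewrite [RHS](bigD1 i)//= eqxx; congr (_ * _); apply: eq_bigr => j /negbTE ->.
  apply: cvg_prodr => j; case: ifP => [/eqP ->|_]; [exact: qcvg|exact: bcvg].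
Unshelve. all: by end_near. Qed.

(** * Integration by parts under bounded limits; boxes generate the Borel sets *)

Lemma integrableM_bounded d (T : measurableType d) (R : realType)
    (mu : {measure set T -> \bar R}) (D : set T) (u v : T -> R) (M : R) :
  measurable D -> mu.-integrable D (EFin \o u) -> measurable_fun D v ->
  (forall x, D x -> `|v x| <= M) ->
  mu.-integrable D (EFin \o (fun x => v x * u x)).
Proof.
move=> mD iu mv vM; have := @integrableMr _ _ _ mu D mD v _ mv _ iu.
apply; exists M; split; first exact: num_real.
by move=> y My x Dx; exact: le_trans (vM _ Dx) (ltW My).
Qed.

Lemma cvg_Rintegral_bounded d (T : measurableType d) (R : realType)
    (mu : {measure set T -> \bar R}) (D : set T) (u : T -> R)
    (v_ : nat -> T -> R) (v : T -> R) (M : R) :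
  measurable D -> mu.-integrable D (EFin \o u) ->
  (forall k, measurable_fun D (v_ k)) ->
  (forall k x, D x -> `|v_ k x| <= M) ->
  (forall x, D x -> v_ k x @[k --> \oo] --> v x) ->
  Rintegral mu D (fun x => v_ k x * u x) @[k --> \oo] -->
  Rintegral mu D (fun x => v x * u x).
Proof.
move=> mD iu mv vM vv.
have mu' : measurable_fun D u by apply/measurable_EFinP; exact: measurable_int iu.
have mvl : measurable_fun D v by apply: (measurable_fun_cvg mv).
have iM : mu.-integrable D (fun x => (`|M| * `|u x|)%:E).
  by under eq_fun do rewrite EFinM; apply: integrableZl => //; exact: integrable_norm.
have ae_cvg : {ae mu, forall x, D x -> (v_ k x * u x)%:E @[k --> \oo] --> (v x * u x)%:E}.
  apply: aeW => x Dx; apply: cvg_EFin; first exact: nearW.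
  by apply: cvgM; [exact: vv|exact: cvg_cst].
have dom : {ae mu, forall x k, D x -> (`|(v_ k x * u x)%:E| <= (`|M| * `|u x|)%:E)%E}.
  apply: aeW => x k Dx; rewrite abse_EFin lee_fin normrM ler_wpM2r//.
  by apply: le_trans (vM k x Dx) _; exact: ler_norm.
have [il _ c] := dominated_convergence mD
    (fun k => (measurable_EFinP _ _).2 (measurable_funM (mv k) mu'))
    ((measurable_EFinP _ _).2 (measurable_funM mvl mu')) ae_cvg iM dom.
apply: fine_cvg; rewrite fineK //.
exact: (integrable_fin_num mD il).
Qed.

Section integration_by_parts_pairs.
Context d (T : measurableType d) (R : realType).
Variables (lam mp mm : {measure set T -> \bar R}) (D : set T) (f fa : T -> R).
Hypotheses (mD : measurable D) (fint : lam.-integrable D (EFin \o f))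
  (faint : lam.-integrable D (EFin \o fa)) (mpD : (mp D < +oo)%E)
  (mmD : (mm D < +oo)%E).

(* For a test function [phi] and [psi = d_i phi] this is the definition of the
   derivative; pairs with the same property survive bounded pointwise limits,
   where [phi] is no longer differentiable. *)
Definition ibp (psi phi : T -> R) : Prop :=
  [/\ measurable_fun D psi, measurable_fun D phi,
      exists M : R, forall x, D x -> `|psi x| <= M /\ `|phi x| <= M &
      Rintegral lam D (fun x => psi x * f x) +
      (Rintegral lam D (fun x => phi x * fa x) +
       Rintegral mp D (fun x => phi x * 1) - Rintegral mm D (fun x => phi x * 1)) = 0].

(** The factor [* 1] in the singular terms of [ibp] gives all four integrals the shape of a bounded
    weight times an integrable function, so one convergence lemma covers them all. *)
Lemma integrable_one (mu : {measure set T -> \bar R}) :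
  (mu D < +oo)%E -> mu.-integrable D (EFin \o (fun=> 1 : R)).
Proof.
move=> muD; apply: measurable_bounded_integrable => //.
by exists 1; split; [exact: num_real|move=> y y1 x _ /=; rewrite normr1 ltW].
Qed.

Lemma ibpB (psi phi psi' phi' : T -> R) : ibp psi phi -> ibp psi' phi' ->
  ibp (fun x => psi x - psi' x) (fun x => phi x - phi' x).
Proof.
move=> [m1 m2 [M HM] E] [m1' m2' [M' HM'] E']; split.
- exact: measurable_funB.
- exact: measurable_funB.
- exists (M + M') => x Dx; have [? ?] := HM x Dx; have [? ?] := HM' x Dx.
  by split; (apply: le_trans (ler_normB _ _) _; apply: lerD).
- have HMl x (Dx : D x) := (HM x Dx).1; have HMr x (Dx : D x) := (HM x Dx).2.
  have HMl' x (Dx : D x) := (HM' x Dx).1; have HMr' x (Dx : D x) := (HM' x Dx).2.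
  have B (mu : {measure set T -> \bar R}) (u v v' : T -> R) (N N' : R) : mu.-integrable D (EFin \o u) ->
      measurable_fun D v -> measurable_fun D v' ->
      (forall x, D x -> `|v x| <= N) -> (forall x, D x -> `|v' x| <= N') ->
      Rintegral mu D (fun x => (v x - v' x) * u x) =
      Rintegral mu D (fun x => v x * u x) - Rintegral mu D (fun x => v' x * u x).
    move=> iu mv mv' vN vN'.
    rewrite -RintegralB//; last 2 first.
    + exact: integrableM_bounded vN.
    + exact: integrableM_bounded vN'.
    by apply: eq_Rintegral => x _; rewrite mulrBl.
  rewrite (B _ _ _ _ _ _ fint m1 m1' HMl HMl') (B _ _ _ _ _ _ faint m2 m2' HMr HMr').
  rewrite (B _ _ _ _ _ _ (integrable_one mpD) m2 m2' HMr HMr').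
  rewrite (B _ _ _ _ _ _ (integrable_one mmD) m2 m2' HMr HMr').
  by move: E E'; lra.
Qed.

Lemma ibp_cvg (psi_ phi_ : nat -> T -> R) (psi phi : T -> R) (M : R) :
  (forall k, ibp (psi_ k) (phi_ k)) ->
  (forall k x, D x -> `|psi_ k x| <= M /\ `|phi_ k x| <= M) ->
  (forall x, D x -> psi_ k x @[k --> \oo] --> psi x) ->
  (forall x, D x -> phi_ k x @[k --> \oo] --> phi x) ->
  ibp psi phi.
Proof.
move=> H HM psic phic.
have m1 k : measurable_fun D (psi_ k) by have [] := H k.
have m2 k : measurable_fun D (phi_ k) by have [] := H k.
have HMl k x (Dx : D x) := (HM k x Dx).1; have HMr k x (Dx : D x) := (HM k x Dx).2.
have lim_le (v_ : nat -> T -> R) (v : T -> R) : (forall k x, D x -> `|v_ k x| <= M) ->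
    (forall x, D x -> v_ k x @[k --> \oo] --> v x) -> forall x, D x -> `|v x| <= M.
  move=> vM vv x Dx; apply: cvgr_to_le (cvg_norm (vv x Dx)) _.
  by apply: nearW => k; exact: vM.
split.
- exact: (measurable_fun_cvg m1).
- exact: (measurable_fun_cvg m2).
- by exists M => x Dx; split; [exact: (lim_le psi_)|exact: (lim_le phi_)].
- have c1 := cvg_Rintegral_bounded mD fint m1 HMl psic.
  have c2 := cvg_Rintegral_bounded mD faint m2 HMr phic.
  have c3 := cvg_Rintegral_bounded mD (integrable_one mpD) m2 HMr phic.
  have c4 := cvg_Rintegral_bounded mD (integrable_one mmD) m2 HMr phic.
  set L := (X in X = 0).
  have c : (cst 0 : nat -> R) @ \oo --> L.
    rewrite (_ : cst 0 = fun k => Rintegral lam D (fun x => psi_ k x * f x) +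
      (Rintegral lam D (fun x => phi_ k x * fa x) +
       Rintegral mp D (fun x => phi_ k x * 1) - Rintegral mm D (fun x => phi_ k x * 1))).
      by apply: cvgD c1 _; apply: cvgB c4; exact: cvgD.
    by apply/funext => k; have [_ _ _] := H k.
  exact: (cvg_unique (@Rhausdorff R) c (cvg_cst _)).
Qed.

End integration_by_parts_pairs.

Definition boxes (R : realType) (n : nat) : set (set 'rV[R]_n) :=
  [set A | exists a b : 'rV[R]_n, (forall j, a 0 j <= b 0 j) /\ A = box a b].

Lemma box_setI (R : realType) (n : nat) (a b A B : 'rV[R]_n) :
  (forall j, A 0 j <= B 0 j) ->
  exists lo hi : 'rV[R]_n, box a b `&` box A B = box lo hi /\
    forall j, A 0 j <= lo 0 j /\ lo 0 j <= hi 0 j /\ hi 0 j <= B 0 j.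
Proof.
move=> AB.
(* The corners are clamped so that an empty intersection is still a box with ordered corners lying
   between [A] and [B]. *)
pose lo : 'rV[R]_n := \row_j Num.min (B 0 j) (Num.max (a 0 j) (A 0 j)).
pose hi : 'rV[R]_n := \row_j Num.max (lo 0 j) (Num.min (b 0 j) (B 0 j)).
exists lo, hi; split; last first.
  move=> j; rewrite !mxE le_min AB !le_max !lexx orbT/=; split=> //; split => //.
  by rewrite ge_max !ge_min !lexx orbT.
have E x : (box a b `&` box A B) x <-> box lo hi x.
  split.
    move=> [H1 H2] j; move: (H1 j) (H2 j); rewrite !mxE.
    rewrite gt_min gt_max le_max !le_min le_max !ltNge.
    by case: (_ <= a 0 j); case: (_ <= A 0 j); case: (_ <= b 0 j); case: (_ <= B 0 j).
  move=> H; split=> j; move: (H j); rewrite !mxE;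
    rewrite gt_min gt_max le_max !le_min le_max !ltNge;
    by case: (_ <= a 0 j); case: (_ <= A 0 j); case: (_ <= b 0 j); case: (_ <= B 0 j).
by apply/seteqP; split=> x /E.
Qed.

Lemma boxes_setI_closed (R : realType) (n : nat) : setI_closed (@boxes R n).
Proof.
move=> _ _ [a [b [_ ->]]] [A [B [AB ->]]].
have [lo [hi [-> H]]] := box_setI a b AB.
by exists lo, hi; split=> // j; have [_ []] := H j.
Qed.

(** Rational corners make the family countable. The margin [r] leaves room for moving the box in
    direction [e_i] without leaving [U]. *)
Lemma open_rat_box (R : realType) (n : nat) (U : set 'rV[R]_n) (x : 'rV[R]_n) :
  open U -> U x -> exists (p : 'rV[rat]_n * 'rV[rat]_n) (r : R),
    let a := map_mx ratr p.1 in let b := map_mx ratr p.2 in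
    [/\ 0 < r, box a b x, forall j, a 0 j <= b 0 j &
        [set y : 'rV[R]_n | forall j, a 0 j <= y 0 j <= b 0 j + r] `<=` U].
Proof.
move=> oU Ux; have /nbhs_ballP[e e0 eU] := open_nbhs_nbhs (conj oU Ux).
have /choice[p Hp] : forall j, exists q : rat, (ratr q : R) \in `]x 0 j - e / 4, x 0 j[.
  by move=> j; apply: rat_in_itvoo; rewrite /= in e0 *; lra.
have /choice[q Hq] : forall j, exists q : rat, (ratr q : R) \in `]x 0 j, x 0 j + e / 4[.
  by move=> j; apply: rat_in_itvoo; rewrite /= in e0 *; lra.
rewrite /= in e0.
exists (\row_j p j, \row_j q j), (e / 4); split=> /=; first by lra.
- by move=> j; rewrite !mxE; have := Hp j; have := Hq j; rewrite !in_itv/=; lra.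
- by move=> j; rewrite !mxE; have := Hp j; have := Hq j; rewrite !in_itv/=; lra.
- move=> y Hy; apply: eU; split=> // i j; rewrite (ord1 i).
  have := Hy j; rewrite !mxE; have := Hp j; have := Hq j; rewrite !in_itv/=.
  move=> /andP[? ?] /andP[? ?] /andP[? ?].
  by rewrite /ball/= ltr_norml; apply/andP; split; lra.
Qed.

Lemma measurable_box (R : realType) (n : nat) (a b : 'rV[R]_n) :
  measurable (box a b : set (Rn R n)).
Proof.
have co (j : 'I_n) : continuous (fun x : 'rV[R]_n => x 0 j) by exact: coord_continuous.
have mo (c : R) (j : 'I_n) : measurable ([set x : 'rV[R]_n | c < x 0 j] : set (Rn R n)).
  apply: sub_sigma_algebra; apply: (@open_comp _ _ (fun x : 'rV[R]_n => x 0 j) [set y | c < y]).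
    by move=> x _; exact: co.
  exact: open_gt.
rewrite (_ : box a b = \bigcap_(j in [set: 'I_n])
   ([set x : 'rV[R]_n | a 0 j < x 0 j] `&` ~` [set x : 'rV[R]_n | b 0 j < x 0 j])).
  apply: (@fin_bigcap_measurable _ (Rn R n)) => // j _.
  by apply: measurableI; [exact: mo|apply: measurableC; exact: mo].
apply/seteqP; split=> x /=.
  by move=> H j _; have /andP[? ?] := H j; split=> //=; apply/negP; rewrite -leNgt.
by move=> H j; have [/= ? /negP] := H j I; rewrite -leNgt => ->; apply/andP.
Qed.

(** An open set is the union of the rational boxes it contains, and there are only countably many of
    these. *)
Lemma measurable_RnE (R : realType) (n : nat) :
  @measurable _ (Rn R n) = <<s @boxes R n >>.
Proof.
apply/seteqP; split; last first.
  apply: smallest_sub; first exact: sigma_algebra_measurable.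
  by move=> _ [a [b [_ ->]]]; exact: measurable_box.
apply: smallest_sub; first exact: smallest_sigma_algebra.
move=> U oU.
pose D := [set p : 'rV[rat]_n * 'rV[rat]_n | box (map_mx ratr p.1) (map_mx ratr p.2) `<=` U /\
  forall j, (ratr (p.1 0 j) : R) <= ratr (p.2 0 j)].
pose F p : set 'rV[R]_n := if p \in D then box (map_mx ratr p.1) (map_mx ratr p.2) else set0.
rewrite (_ : U = \bigcup_p F p).
  apply: (@countable_bigcupT_measurable _ (g_sigma_algebraType (@boxes R n))) => [|p].
    exact: countableP.
  rewrite /F; case: ifPn => [|_]; last exact: measurable0.
  rewrite inE => -[_ H]; apply: sub_sigma_algebra.
  by exists (map_mx ratr p.1), (map_mx ratr p.2); split=> // j; rewrite !mxE.
apply/seteqP; split=> x.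
  move=> Ux; have [p [r [r0 px pab pU]]] := open_rat_box oU Ux.
  exists p => //; rewrite /F ifT// inE; split; last by move=> j; have := pab j; rewrite !mxE.
  move=> y py; apply: pU => j; have /andP[/ltW -> yb] := py j.
  by rewrite (le_trans yb)// lerDl ltW.
by move=> [p _]; rewrite /F; case: ifPn => //; rewrite inE => -[+ _]; exact.
Qed.

Lemma bigcup_boxT (R : realType) (n : nat) :
  \bigcup_k box (const_mx (- k%:R)) (const_mx k%:R) = [set: 'rV[R]_n].
Proof.
apply/seteqP; split=> // x _.
have /choice[N HN] : forall j, exists k : nat, `|x 0 j| < k%:R.
  move=> j; exists (Num.bound `|x 0 j|); exact: (archi_boundP (normr_ge0 _)).
exists (\max_j N j)%N => // j; rewrite !mxE.
have : `|x 0 j| < (\max_j N j)%:R.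
  by apply: lt_le_trans (HN j) _; rewrite ler_nat; exact: leq_bigmax.
by rewrite ltr_norml => /andP[-> /ltW].
Qed.

(** Dynkin's theorem for the intersection-stable family of boxes. The whole space is an increasing
    union of boxes, so it is obtained from the first and third premises. *)
Lemma box_induction (R : realType) (n : nat) (P : set (set (Rn R n))) :
  (forall a b : 'rV[R]_n, (forall j, a 0 j <= b 0 j) -> P (box a b)) ->
  (forall A B, measurable A -> measurable B -> B `<=` A -> P A -> P B -> P (A `\` B)) ->
  (forall F : nat -> set (Rn R n), (forall k, measurable (F k)) ->
     nondecreasing_seq F -> (forall k, P (F k)) -> P (\bigcup_k F k)) ->
  forall A, measurable A -> P A.
Proof.
move=> Pbox PD PU A mA.
suff : <<s @boxes R n >> `<=` [set A | measurable (A : set (Rn R n)) /\ P A].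
  by move=> /(_ A); rewrite -measurable_RnE => /(_ mA)[].
apply: lambda_system_subset => //; first exact: boxes_setI_closed.
  split=> //.
  - split; first exact: measurableT.
    rewrite -(bigcup_boxT R n); apply: PU.
    + by move=> k; exact: measurable_box.
    + move=> k l kl; apply/subsetPset => x xk j; have := xk j; rewrite !mxE => /andP[xk1 xk2].
      by rewrite (le_lt_trans _ xk1) ?lerN2 ?ler_nat// (le_trans xk2)// ler_nat.
    + by move=> k; apply: Pbox => j; rewrite !mxE ge0_cp.
  - move=> B C CB [mB PB] [mC PC]; split; first exact: measurableD.
    exact: PD.
  - move=> F ndF HF; split; first by apply: bigcupT_measurable => k; have [] := HF k.
    by apply: PU => // k; have [] := HF k.
move=> _ [a [b [ab ->]]]; split; [exact: measurable_box|exact: Pbox].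
Qed.

(** * Translations and averages over segments *)

Lemma measurable_fun_Rn d (T : measurableType d) (R : realType) (n : nat)
    (g : T -> 'rV[R]_n) :
  (forall j, measurable_fun setT (fun x => g x 0 j)) ->
  measurable_fun setT (g : T -> Rn R n).
Proof.
move=> mg; apply: (measurability _ (measurable_RnE R n)) => //.
move=> _ [_ [a [b [_ ->]]] <-]; rewrite setTI.
rewrite (_ : _ @^-1` _ = \bigcap_(j in [set: 'I_n])
   (setT `&` (fun x => g x 0 j) @^-1` `]a 0 j, b 0 j]%classic)).
  apply: fin_bigcap_measurable => // j _.
  by apply: mg => //; exact: measurable_itv.
apply/seteqP; split=> x /=.
  by move=> H j _; split=> //=; rewrite in_itv/=; exact: H.
by move=> H j; have [_ /=] := H j I; rewrite in_itv.
Qed.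

Lemma measurable_coord (R : realType) (n : nat) (j : 'I_n) :
  measurable_fun [set: Rn R n] (fun x : Rn R n => (x : 'rV[R]_n) 0 j).
Proof.
apply: (measurability _ (RGenOInfty.measurableE R)) => //.
move=> _ [_ [c ->] <-]; rewrite setTI; apply: sub_sigma_algebra.
apply: (@open_comp _ _ (fun x : 'rV[R]_n => x 0 j)); last exact: interval_open.
by move=> x _; exact: coord_continuous.
Qed.

Lemma continuous_measurable_Rn (R : realType) (n : nat) (u : 'rV[R]_n -> R)
    (D : set (Rn R n)) :
  continuous u -> measurable_fun D (u : Rn R n -> R).
Proof.
move=> cu; apply: measurable_funTS.
apply: (measurability _ (RGenOInfty.measurableE R)) => //.
move=> _ [_ [c ->] <-]; rewrite setTI; apply: sub_sigma_algebra.
apply: (@open_comp _ _ u); last exact: interval_open.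
by move=> x _; exact: cu.
Qed.

Lemma measurable_translation (R : realType) (n : nat) (v : 'rV[R]_n) :
  measurable_fun setT ((fun x => x + v) : Rn R n -> Rn R n).
Proof.
apply: measurable_fun_Rn => j; under eq_fun do rewrite mxE.
by apply: measurable_funD; [exact: measurable_coord|exact: measurable_cst].
Qed.

Lemma measurable_translate (R : realType) (n : nat) (v : 'rV[R]_n) (A : set (Rn R n)) :
  measurable A -> measurable ([set x : Rn R n | A (x + v)]).
Proof.
by move=> mA; rewrite -[X in measurable X]setTI; exact: measurable_translation.
Qed.

Section lebesgue_Rn.
Variables (R : realType) (n : nat) (lam : {measure set (Rn R n) -> \bar R}).
Hypothesis Hlam : is_lebesgue_measure lam.

(** The translated measure gives boxes the same volume, and the measure is determined by its values
    on boxes. *)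
Lemma lebesgue_translate (v : 'rV[R]_n) (A : set (Rn R n)) :
  measurable A -> lam [set x | A (x + v)] = lam A.
Proof.
move=> mA.
pose phi : Rn R n -> Rn R n := fun x => x + v.
pose push : {measure set (Rn R n) -> \bar R} := pushforward lam phi.
pose m1 := push (measurable_translation v).
have phi_box a b : phi @^-1` (box a b) = box (a - v) (b - v).
  by apply/seteqP; split=> x /= H j; move: (H j); rewrite !mxE ltrBlDr lerBrDr.
have := @measure_unique _ R (Rn R n) (@boxes R n)
  (fun k => box (const_mx (- k%:R)) (const_mx k%:R)) (measurable_RnE R n)
  (@boxes_setI_closed R n) _ (bigcup_boxT R n) m1 lam _ _ A mA.
apply.
- move=> k; exists (const_mx (- k%:R)), (const_mx k%:R); split=> // j.
  by rewrite !mxE ge0_cp.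
- move=> _ [a [b [ab ->]]]; rewrite /m1 /push /= /pushforward phi_box.
  rewrite !Hlam//; last by move=> j; rewrite !mxE lerD2r.
  by congr EFin; apply: eq_bigr => j _; rewrite !mxE; ring.
- move=> k; rewrite /m1 /push /= /pushforward phi_box.
  by rewrite Hlam ?ltry// => j; rewrite !mxE lerD2r ge0_cp.
Qed.

Lemma sigma_finite_lebesgue : sigma_finite setT lam.
Proof.
exists (fun k => box (const_mx (- k%:R)) (const_mx k%:R)); first by rewrite bigcup_boxT.
move=> k; split; first exact: measurable_box.
by rewrite Hlam ?ltry// => j; rewrite !mxE ge0_cp.
Qed.

Lemma integral_translate (v : 'rV[R]_n) (E : set (Rn R n)) (f : Rn R n -> R) :
  measurable E -> lam.-integrable [set x | E (x - v)] (EFin \o f) ->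
  lam.-integrable E (fun x => (f (x + v))%:E) /\
  Rintegral lam [set x | E (x - v)] f = Rintegral lam E (fun x => f (x + v)).
Proof.
move=> mE intf.
pose phi : Rn R n -> Rn R n := fun x => x + v.
pose push : {measure set (Rn R n) -> \bar R} := pushforward lam phi.
pose m1 := push (measurable_translation v).
pose E' : set (Rn R n) := [set x | E (x - v)].
rewrite -[X in integrable _ X]/E' in intf *; rewrite -[X in Rintegral _ X f = _]/E'.
have mE' : measurable (E' : set (Rn R n)) by exact: measurable_translate.
have phiE : phi @^-1` E' = E by apply/seteqP; split=> x; rewrite /= /E'/= addrK.
have m1E (A : set (Rn R n)) : measurable A -> m1 A = lam A.
  by move=> mA; exact: lebesgue_translate.
(* [f] is controlled only on [E'], while the change of variables needs a function measurable
   everywhere; hence the extension by 0. *)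
pose f0 : Rn R n -> \bar R := (EFin \o f) \_ E'.
have mf0 : measurable_fun setT f0.
  have /integrableP[mf _] := intf.
  have H := (measurable_restrictT (EFin \o f) mE').1 mf.
  by move: H; rewrite /f0.
have f0E x : E' x -> f0 x = (f x)%:E by move=> Ex; rewrite /f0 patchE mem_set.
have intf0 : lam.-integrable E' f0.
  by apply: eq_integrable intf => // x; rewrite inE => /f0E ->.
have int1 : lam.-integrable (phi @^-1` E') (f0 \o phi).
  apply/integrableP; split.
    by apply: measurable_funTS; apply: measurableT_comp => //; exact: measurable_translation.
  have /integrableP[_] := intf0; rewrite -(@eq_measure_integral _ _ _ _ _ m1); last first.
    by move=> A mA _; rewrite m1E.
  rewrite /m1 /push (@ge0_integral_pushforward _ _ (Rn R n) (Rn R n) R phi)//=.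
  - exact: measurable_translation.
  - by apply: measurable_funTS; apply: measurableT_comp.
have int2 : lam.-integrable E (fun x => (f (x + v))%:E).
  rewrite -phiE; apply: eq_integrable int1 => //.
    by rewrite phiE.
  by move=> x; rewrite inE => Ex; rewrite /= f0E.
split=> //.
have := @integral_pushforward _ _ (Rn R n) (Rn R n) R phi (measurable_translation v) lam
  E' f0 mf0 int1 mE'.
rewrite -[pushforward _ _]/(m1 : set _ -> _) (@eq_measure_integral _ _ _ _ lam); last by move=> A mA _; rewrite m1E.
rewrite phiE /Rintegral => H; congr fine.
transitivity (\int[lam]_(x in E') f0 x)%E.
  by apply: eq_integral => x; rewrite inE => /f0E ->.
rewrite H; apply: eq_integral => x; rewrite inE => Ex /=.
by rewrite f0E//= /E'/= addrK.
Qed.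

End lebesgue_Rn.

Section segment_average.
Variables (R : realType) (n : nat) (i : 'I_n) (h : R).
Hypothesis h0 : 0 <= h.

(** Presenting the segments as sections of a single product set gives the measurability of their
    lengths at once, and lets Tonelli's theorem integrate these lengths. *)
Definition slab (E : set (Rn R n)) : set (Rn R n * R) :=
  [set p | (0 <= p.2 < h) /\ E ((p.1 : 'rV[R]_n) - p.2 *: evec R i)].

(* [h] times the mean of [\1_E] over the segment of length [h] ending at [x] in
   direction [evec R i]: integrating it against the derivative of [f] yields the
   integral over [E] of the increments of [f]. *)
Definition avg (E : set (Rn R n)) (x : Rn R n) : R :=
  fine (lebesgue_measure (xsection (slab E) x)).

Lemma xsection_slab (E : set (Rn R n)) (x : 'rV[R]_n) :
  xsection (slab E) x = `[0, h[%classic `&` [set t | E (x - t *: evec R i)].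
Proof.
apply/seteqP; split=> t.
  by move=> /xsectionP[/= t0 Et]; split=> //=; rewrite in_itv.
by move=> [/=]; rewrite in_itv/= => t0 Et; apply/xsectionP.
Qed.

Lemma measurable_slab (E : set (Rn R n)) : measurable E -> measurable (slab E).
Proof.
move=> mE; pose phi (p : Rn R n * R) : Rn R n := (p.1 : 'rV[R]_n) - p.2 *: evec R i.
have mphi : measurable_fun setT phi.
  apply: measurable_fun_Rn => j.
  rewrite (_ : (fun p => _) = fun p : Rn R n * R =>
    (p.1 : 'rV[R]_n) 0 j - p.2 * evec R i 0 j); last first.
    by apply/funext => p; rewrite /phi !mxE.
  apply: measurable_funB.
    exact: (measurableT_comp (measurable_coord j) measurable_fst).
  by apply: measurable_funM; [exact: measurable_snd|exact: measurable_cst].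
rewrite (_ : slab E = (setT `&` snd @^-1` `[0, h[%classic) `&` (setT `&` phi @^-1` E)).
  by apply: measurableI; [exact: measurable_snd|exact: mphi].
by rewrite !setTI; apply/seteqP; split=> p /=; rewrite in_itv.
Qed.

Lemma measurable_xslab (E : set (Rn R n)) x :
  measurable E -> measurable (xsection (slab E) x).
Proof. by move=> mE; apply: measurable_xsection; exact: measurable_slab. Qed.

Lemma xslab_le (E : set (Rn R n)) x : measurable E ->
  (lebesgue_measure (xsection (slab E) x) <= h%:E)%E.
Proof.
move=> mE; have -> : h%:E = lebesgue_measure `[0, h[%classic.
  rewrite lebesgue_measure_itv/= lte_fin; case: ltP => [_|h0']; first by rewrite sube0.
  by congr EFin; apply/eqP; rewrite eq_le h0 h0'.
apply: le_measure; rewrite ?inE//; first exact: measurable_xslab.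
by rewrite xsection_slab; exact: subIsetl.
Qed.

Lemma avgE (E : set (Rn R n)) x : measurable E ->
  (avg E x)%:E = lebesgue_measure (xsection (slab E) x).
Proof.
move=> mE; rewrite /avg fineK// ge0_fin_numE//.
by apply: le_lt_trans (xslab_le x mE) _; rewrite ltry.
Qed.

Lemma avg_ge0 (E : set (Rn R n)) x : 0 <= avg E x.
Proof. by rewrite /avg fine_ge0. Qed.

Lemma avg_le (E : set (Rn R n)) x : measurable E -> avg E x <= h.
Proof. by move=> mE; rewrite -lee_fin avgE// xslab_le. Qed.

Lemma measurable_avg (E : set (Rn R n)) : measurable E -> measurable_fun setT (avg E).
Proof.
move=> mE; apply/measurable_EFinP.
rewrite (_ : EFin \o avg E = lebesgue_measure \o xsection (slab E)).
  by apply: measurable_fun_xsection; exact: measurable_slab.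
by apply/funext => x; rewrite /= avgE.
Qed.

Lemma avg_eq0 (E : set (Rn R n)) (x : 'rV[R]_n) :
  (forall t, 0 <= t -> t < h -> ~ E (x - t *: evec R i)) -> avg E x = 0.
Proof.
move=> H; rewrite /avg (_ : xsection _ _ = set0) ?measure0//.
rewrite xsection_slab -subset0 => t [/=]; rewrite in_itv/= => /andP[t0 th].
exact: H.
Qed.

Lemma avgD (A B : set (Rn R n)) x : measurable A -> measurable B -> B `<=` A ->
  avg (A `\` B) x = avg A x - avg B x.
Proof.
move=> mA mB BA; apply: EFin_inj; rewrite EFinB !avgE//; last exact: measurableD.
rewrite (_ : xsection (slab (A `\` B)) x = xsection (slab A) x `\` xsection (slab B) x).
  rewrite measureD; last 3 first.
  - exact: measurable_xslab.
  - exact: measurable_xslab.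
  - by apply: le_lt_trans (xslab_le x mA) _; rewrite ltry.
  congr (_ - lebesgue_measure _)%E; rewrite setIidr// !xsection_slab.
  by apply: setIS => t; exact: BA.
rewrite !xsection_slab; apply/seteqP; split=> t /=.
  by move=> [t0 [At Bt]]; split=> // -[_ /Bt].
by move=> [[t0 At] Bt]; split=> //; split=> // Bt'; apply: Bt.
Qed.

Lemma avg_cvg (F : nat -> set (Rn R n)) x : (forall k, measurable (F k)) ->
  nondecreasing_seq F -> avg (F k) x @[k --> \oo] --> avg (\bigcup_k F k) x.
Proof.
move=> mF ndF; apply: fine_cvg.
have mU : measurable (\bigcup_k F k) by exact: bigcupT_measurable.
rewrite avgE// (_ : xsection (slab (\bigcup_k F k)) x = \bigcup_k xsection (slab (F k)) x).
  apply: nondecreasing_cvg_mu.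
  - by move=> k; exact: measurable_xslab.
  - by apply: bigcupT_measurable => k; exact: measurable_xslab.
  - move=> k l kl; apply/subsetPset; rewrite !xsection_slab; apply: setIS => t /=.
    by move: kl => /ndF /subsetPset; apply.
rewrite !xsection_slab; apply/seteqP; split=> t.
  by move=> [t0 [k _ Ft]]; exists k => //; rewrite xsection_slab.
by move=> [k _]; rewrite xsection_slab => -[t0 Ft]; split=> //; exists k.
Qed.

Lemma avg_box (a b x : 'rV[R]_n) : a 0 i <= b 0 i ->
  avg (box a b) x = tent h (a 0 i) (b 0 i) (x 0 i) *
     \prod_(j < n | j != i) ((a 0 j < x 0 j <= b 0 j)%R%:R : R).
Proof.
move=> ab; have h_ge0 := h0.
have coord t j : (x - t *: evec R i) 0 j = if j == i then x 0 i - t else x 0 j.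
  by rewrite !mxE eqxx/=; case: eqP => [->|_]; rewrite ?mulr1// mulr0 subr0.
have [/forallP H|] := boolP [forall j, (j != i) ==> (a 0 j < x 0 j <= b 0 j)].
  rewrite big1 ?mulr1; last by move=> j ji; move: (H j); rewrite ji/= => ->.
  (* Once the other coordinates lie in the box, [a < x - t <= b] reads [x - b <= t < x - a] in
     coordinate [i], so the section is an interval. *)
  rewrite /avg xsection_slab (_ : _ `&` _ =
     `[Num.max 0 (x 0 i - b 0 i), Num.min h (x 0 i - a 0 i)[%classic).
    rewrite lebesgue_measure_itv/= lte_fin -EFinB /tent.
    case: (leP (x 0 i - a 0 i) 0) => ?; case: (leP (x 0 i - b 0 i) 0) => ?;
    case: (leP (x 0 i - h - a 0 i) 0) => ?; case: (leP (x 0 i - h - b 0 i) 0) => ?;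
    case: (leP h (x 0 i - a 0 i)) => ?; case: ifPn; rewrite -?leNgt/= => ?; lra.
  apply/seteqP; split=> t /=; rewrite !in_itv/= ge_max lt_min.
    move=> [/andP[-> ->]] /(_ i); rewrite coord eqxx => /andP[? ?].
    by apply/andP; split; lra.
  move=> /andP[/andP[-> ?] /andP[-> ?]]; split=> // j; rewrite coord.
  case: eqP => [->|/eqP ji]; first by apply/andP; split; lra.
  by move: (H j); rewrite ji.
rewrite negb_forall => /existsP[j]; rewrite negb_imply => /andP[ji xj].
rewrite (bigD1 j)//= (negbTE xj) mul0r mulr0; apply: avg_eq0 => t _ _ /(_ j).
by rewrite coord (negbTE ji) (negbTE xj).
Qed.

(** By Tonelli this is the integral over [t] in [[0, h[] of the measure of [E] translated by
    [t e_i], which is constant in [t]. *)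
Lemma integral_avg (lam : {measure set (Rn R n) -> \bar R}) (E : set (Rn R n)) :
  is_lebesgue_measure lam -> measurable E ->
  (\int[lam]_x (avg E x)%:E = h%:E * lam E)%E.
Proof.
move=> Hlam mE.
pose H3 := isSigmaFinite.Build _ _ _ _ (sigma_finite_lebesgue Hlam).
pose H2 := isSFinite.Build _ _ _ _
  (sfinite_measure_sigma_finite (sigma_finite_lebesgue Hlam)).
pose lam' := HB.pack_for (SigmaFiniteMeasure.type (Rn R n) R) (Measure.sort lam) H2 H3.
have lamE : lam = lam' by exact: eq_measure.
have mS := measurable_slab mE.
have := indic_fubini_tonelli lam' (@lebesgue_measure R) mS.
rewrite indic_fubini_tonelli_FE// indic_fubini_tonelli_GE//.
rewrite (_ : (\int[lam']_x _)%E = \int[lam]_x (avg E x)%:E)%E; last first.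
  by rewrite lamE; apply: eq_integral => x _; rewrite /= avgE.
move=> ->; transitivity (\int[@lebesgue_measure R]_(t in `[0%R, h[) cst (lam E) t)%E.
  rewrite [RHS]integral_mkcond; apply: eq_integral => t _ /=.
  rewrite patchE; case: ifPn; rewrite ?inE ?notin_setE/= => t0.
    rewrite -(lebesgue_translate Hlam (- (t *: evec R i)) mE); congr (lam _).
    rewrite in_itv/= in t0.
    by apply/seteqP; split=> x; [move=> /ysectionP[]|move=> ?; apply/ysectionP].
  rewrite (_ : ysection _ _ = set0) ?measure0//.
  by rewrite -subset0 => x /ysectionP[/=]; rewrite in_itv/= in t0.
have h00 : lebesgue_measure `[0%R, h[%classic = h%:E.
  rewrite lebesgue_measure_itv/= lte_fin; case: ltP => [_|h0']; first by rewrite sube0.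
  by congr EFin; apply/eqP; rewrite eq_le h0 h0'.
transitivity (lam E * lebesgue_measure (`[0%R, h[%classic : set R))%E.
  by rewrite integral_cst.
by rewrite h00 muleC.
Qed.

End segment_average.

(** * The difference quotient identity *)

Lemma Rintegral_indicM d (T : measurableType d) (R : realType)
    (mu : {measure set T -> \bar R}) (D E : set T) (u : T -> R) : E `<=` D ->
  Rintegral mu D (fun x => \1_E x * u x) = Rintegral mu E u.
Proof.
move=> ED; rewrite -{2}(setIidr ED) Rintegral_mkcondr; apply: eq_Rintegral => x _.
by rewrite patchE indicE; case: (x \in E); rewrite ?mul1r// mul0r.
Qed.

Lemma cvg_indic_bigcup (T : Type) (R : realType) (F : nat -> set T) (x : T) :
  nondecreasing_seq F -> (\1_(F k) x : R) @[k --> \oo] --> (\1_(\bigcup_k F k) x : R).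
Proof.
move=> ndF; apply: cvg_near_cst; rewrite indicE.
have [|] := boolP (x \in _); rewrite ?inE ?notin_setE => xF.
  have [k _ Fk] := xF; exists k => // l /= kl; rewrite indicE mem_set//.
  by move: kl Fk => /ndF /subsetPset; apply.
apply: nearW => k; rewrite indicE memNset// => Fk; apply: xF; by exists k.
Qed.

Lemma indicD (T : Type) (R : realType) (A B : set T) (x : T) : B `<=` A ->
  \1_(A `\` B) x = \1_A x - \1_B x :> R.
Proof.
move=> BA; rewrite !indicE in_setD; have [xB|] := boolP (x \in B).
  by rewrite (_ : x \in A) ?subrr// inE; apply: BA; rewrite inE in xB.
by rewrite andbT subr0.
Qed.

Lemma measurable_indicT d (T : measurableType d) (R : realType) (D E : set T) :
  measurable E -> measurable_fun D (\1_E : T -> R).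
Proof. by move=> mE; apply: measurable_funTS; exact: measurable_indic. Qed.

Section difference_quotient.
Variables (R : realType) (n : nat) (lam : {measure set (Rn R n) -> \bar R}).
Hypothesis Hlam : is_lebesgue_measure lam.
Variables (Omega : set (Rn R n)) (f fa : Rn R n -> R)
  (mp mm : {measure set (Rn R n) -> \bar R}) (i : 'I_n).
Hypotheses (mO : measurable Omega) (Hf : lam.-integrable Omega (EFin \o f))
  (Hfa : lam.-integrable Omega (EFin \o fa))
  (Hmp : (mp Omega < +oo)%E) (Hmm : (mm Omega < +oo)%E).
Hypothesis HDf : forall phi : 'rV[R]_n -> R, test_function Omega phi ->
  Rintegral lam Omega (fun x => f x * partial i phi x) =
  - (Rintegral lam Omega (fun x => phi x * fa x) + Rintegral mp Omega phi
     - Rintegral mm Omega phi).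
Variables (A B : 'rV[R]_n) (r : R).
Hypotheses (AB : forall j, A 0 j <= B 0 j)
  (QO : [set x : 'rV[R]_n | forall j, A 0 j <= x 0 j <= B 0 j + r] `<=` Omega).

Let e := evec R i.
Let Q : set (Rn R n) := box A B.

(** The test functions of [box_test_functions] satisfy [ibp] by the definition of the derivative; by
    [avg_box] their limit is [avg] of the box. *)
Lemma ibp_box (h : R) (a b : 'rV[R]_n) : 0 < h -> h < r ->
  (forall j, A 0 j <= a 0 j /\ a 0 j <= b 0 j /\ b 0 j <= B 0 j) ->
  ibp lam mp mm Omega f fa
    (fun x => \1_(box a b) x - \1_(box a b) (x - h *: e)) (avg i h (box a b)).
Proof.
move=> h0 hr ab.
have ab' j : a 0 j <= b 0 j by have [_ []] := ab j.
have abO : [set x : 'rV[R]_n | forall j, a 0 j <= x 0 j <= b 0 j + r] `<=` Omega.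
  move=> x xab; apply: QO => j; have [Aa [_ bB]] := ab j.
  have /andP[ax xb] := xab j; apply/andP; split; first exact: le_trans ax.
  by apply: le_trans xb _; rewrite lerD2r.
have [psi [phi [M [tphi dphi cont HM Hcvg]]]] := box_test_functions i ab' h0 hr abO.
have mpsi k (D : set (Rn R n)) : measurable_fun D (psi k : Rn R n -> R).
  by apply: continuous_measurable_Rn; have [] := cont k.
have mpsi' k : measurable_fun Omega (fun x : Rn R n => psi k ((x : 'rV[R]_n) - h *: e)).
  apply: measurable_funTS; apply: (measurableT_comp (mpsi k setT)).
  exact: measurable_translation.
apply: (@ibp_cvg _ _ _ _ _ _ _ _ _ mO Hf Hfa Hmp Hmm
  (fun k x => psi k x - psi k (x - h *: e)) phi _ _ (M + M)).
- move=> k; split.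
  + exact: measurable_funB.
  + by apply: continuous_measurable_Rn; have [] := cont k.
  + exists (M + M) => x _; split.
      by apply: le_trans (ler_normB _ _) _; apply: lerD; have [] := HM k x; have [] := HM k (x - h *: e).
    by apply: le_trans (HM k x).2 _; rewrite lerDl; apply: le_trans (HM k x).2.
  + have E1 : Rintegral lam Omega (fun x => (psi k x - psi k (x - h *: e)) * f x) =
        Rintegral lam Omega (fun x => f x * partial i (phi k) x).
      by apply: eq_Rintegral => x _; rewrite dphi mulrC.
    have E2 (mu : {measure set (Rn R n) -> \bar R}) :
        Rintegral mu Omega (fun x => phi k x * 1) = Rintegral mu Omega (phi k).
      by apply: eq_Rintegral => x _; rewrite mulr1.
    by rewrite E1 !E2 (HDf (tphi k)) addNr.
- move=> k x _; split.
    by apply: le_trans (ler_normB _ _) _; apply: lerD; have [] := HM k x; have [] := HM k (x - h *: e).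
  by apply: le_trans (HM k x).2 _; rewrite lerDl; apply: le_trans (HM k x).2.
- by move=> x _; apply: cvgB; [exact: (Hcvg x).1|exact: (Hcvg (x - h *: e)).1].
- by move=> x _; rewrite avg_box// ?ltW//; exact: (Hcvg x).2.
Qed.

(** Cutting by [Q] keeps every set of the induction away from the boundary of [Omega], and it
    commutes with differences and increasing unions. *)
Lemma ibp_borel (h : R) (E : set (Rn R n)) : 0 < h -> h < r -> measurable E ->
  ibp lam mp mm Omega f fa
    (fun x => \1_(E `&` Q) x - \1_(E `&` Q) ((x : 'rV[R]_n) - h *: e)) (avg i h (E `&` Q)).
Proof.
move=> h0 hr; have h0' := ltW h0.
have mQ : measurable Q by exact: measurable_box.
pose P (E : set (Rn R n)) := ibp lam mp mm Omega f fa
    (fun x => \1_(E `&` Q) x - \1_(E `&` Q) ((x : 'rV[R]_n) - h *: e)) (avg i h (E `&` Q)).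
apply: (@box_induction R n P).
- move=> a b _; rewrite /P /Q; have [lo [hi [-> H]]] := box_setI a b AB.
  exact: ibp_box.
- move=> E1 E2 m1 m2 E21 P1 P2; rewrite /P.
  have -> : (E1 `\` E2) `&` Q = (E1 `&` Q) `\` (E2 `&` Q).
    apply/seteqP; split=> x; first by move=> [[? H] ?]; split=> // -[].
    by move=> [[? ?] H]; split=> //; split=> // ?; apply: H.
  have sub : E2 `&` Q `<=` E1 `&` Q by exact: setSI.
  have := ibpB mO Hf Hfa Hmp Hmm P1 P2; congr ibp; apply/funext => x.
    by rewrite !indicD//; ring.
  by rewrite avgD//; exact: measurableI.
- move=> F mF ndF PF; rewrite /P setI_bigcupl.
  have ndF' : nondecreasing_seq (fun k => F k `&` Q).
    by move=> k l kl; apply/subsetPset; apply: setSI; exact/subsetPset/ndF.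
  have mF' k : measurable (F k `&` Q) by exact: measurableI.
  have ind1 (D : set (Rn R n)) x : `|\1_D x : R| <= 1.
    by rewrite indicE; case: (_ \in _); rewrite ?normr1 ?normr0.
  apply: (@ibp_cvg _ _ _ _ _ _ _ _ _ mO Hf Hfa Hmp Hmm _ _ _ _ (1 + 1 + h)) PF _ _ _.
  + move=> k x _; split.
      apply: le_trans (ler_normB _ _) _; apply: (@le_trans _ _ (1 + 1)); last by rewrite lerDl.
      by apply: lerD; exact: ind1.
    by rewrite ger0_norm ?avg_ge0//; apply: le_trans (avg_le i h0' x (mF' k)) _; rewrite lerDr.
  + by move=> x _; apply: cvgB; exact: cvg_indic_bigcup.
  + by move=> x _; exact: avg_cvg.
Qed.

(** The translated indicator in [ibp_borel] is moved onto [f] by a change of variables, which turns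
    the first integral into increments of [f] over [E]. *)
Lemma difference_quotientE (h : R) (E : set (Rn R n)) : 0 < h -> h < r ->
  measurable E -> E `<=` Q ->
  lam.-integrable E (fun x => (f ((x : 'rV[R]_n) + h *: e))%:E) /\
  Rintegral lam E (fun x => f ((x : 'rV[R]_n) + h *: e)) - Rintegral lam E f =
  Rintegral lam Omega (fun x => avg i h E x * fa x) +
  Rintegral mp Omega (fun x => avg i h E x * 1) -
  Rintegral mm Omega (fun x => avg i h E x * 1).
Proof.
move=> h0 hr mE EQ; have := ibp_borel h0 hr mE; rewrite (setIidl EQ) => -[_ _ _ H].
pose E' : set (Rn R n) := [set x | E ((x : 'rV[R]_n) - h *: e)].
have mE' : measurable E' by exact: measurable_translate.
have QO' (x : 'rV[R]_n) t : Q (x - t *: e) -> 0 <= t -> t <= h -> Omega x.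
  move=> Qx t0 th; apply: QO => j; have := Qx j; rewrite !mxE eqxx/=.
  by case: (j == i); rewrite ?mulr1 ?mulr0 => /andP[? ?]; apply/andP; split; lra.
have EO : E `<=` Omega.
  by move=> x Ex; apply: (QO' x 0) => //; [rewrite scale0r subr0; exact: EQ|exact: ltW].
have E'O : E' `<=` Omega by move=> x Ex; apply: (QO' x h) => //; [exact: EQ|exact: ltW].
have intE' : lam.-integrable E' (EFin \o f) by exact: integrableS Hf.
have [int1 int2] := integral_translate Hlam mE intE'.
split=> //; move: H.
have ind1 (D : set (Rn R n)) x : `|\1_D x : R| <= 1.
  by rewrite indicE; case: (_ \in _); rewrite ?normr1 ?normr0.
have -> : Rintegral lam Omega (fun x => (\1_E x - \1_E ((x : 'rV[R]_n) - h *: e)) * f x) =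
    Rintegral lam Omega (fun x => \1_E x * f x - \1_E' x * f x).
  by apply: eq_Rintegral => x _; rewrite mulrBl.
rewrite RintegralB//; last 2 first.
- by apply: (integrableM_bounded mO Hf) (fun x _ => ind1 E x); exact: measurable_indicT.
- by apply: (integrableM_bounded mO Hf) (fun x _ => ind1 E' x); exact: measurable_indicT.
by rewrite !Rintegral_indicM// -int2; lra.
Qed.

End difference_quotient.

(* Short segments ending at a point outside such an [F] do not meet [F], so the
   averages [avg] of subsets of [F] tend to 0 off [F]. Half-open boxes qualify,
   open boxes do not. *)
Definition left_stable (R : realType) (n : nat) (i : 'I_n) (F : set 'rV[R]_n) : Prop :=
  forall x, exists2 d : R, 0 < d &
    forall t, 0 <= t -> t < d -> (F (x - t *: evec R i) <-> F x).

Lemma left_stable_box (R : realType) (n : nat) (i : 'I_n) (a b : 'rV[R]_n) :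
  left_stable i (box a b).
Proof.
move=> x.
(* The distance to the first face met when moving in direction [- e_i]. For [x 0 i <= a 0 i] no face
   is met, and 1 is an arbitrary choice. *)
pose d := if b 0 i < x 0 i then x 0 i - b 0 i else
  if a 0 i < x 0 i then x 0 i - a 0 i else 1.
exists d.
  rewrite /d; case: ifPn => [|_]; first by rewrite subr_gt0.
  by case: ifPn => // ?; rewrite subr_gt0.
move=> t t0 td.
have E j : (a 0 j < (x - t *: evec R i) 0 j <= b 0 j) = (a 0 j < x 0 j <= b 0 j).
  rewrite !mxE eqxx/=; case: eqP => [->|_]; last by rewrite mulr0 subr0.
  rewrite mulr1; move: td; rewrite /d.
  case: ifPn => [bx|]; [|rewrite -leNgt => xb; case: ifPn => [ax|]].
  - move=> td; rewrite [in RHS]leNgt bx andbF; apply/negbTE; rewrite negb_and -!ltNge.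
    by apply/orP; right; lra.
  - by move=> td; rewrite xb/=; apply/andP; split; lra.
  - rewrite -leNgt => xa td; apply/negbTE.
    by rewrite negb_and -leNgt; apply/orP; left; lra.
by split=> H j; have := H j; rewrite E.
Qed.

Lemma left_stableD (R : realType) (n : nat) (i : 'I_n) (F G : set 'rV[R]_n) :
  left_stable i F -> left_stable i G -> left_stable i (F `\` G).
Proof.
move=> sF sG x; have [d1 d10 H1] := sF x; have [d2 d20 H2] := sG x.
exists (Num.min d1 d2); first by rewrite lt_min d10.
move=> t t0; rewrite lt_min => /andP[td1 td2].
by have := H1 t t0 td1; have := H2 t t0 td2; rewrite /setD/=; tauto.
Qed.

(** Left stability survives differences but not countable unions. An increasing union is therefore
    replaced by one of its terms, which loses little because [mu] is finite. *)
Lemma approximation_left_stable (R : realType) (n : nat) (i : 'I_n)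
    (mu : {measure set (Rn R n) -> \bar R}) : (mu setT < +oo)%E ->
  forall E : set (Rn R n), measurable E -> forall d : R, 0 < d ->
  exists F : set (Rn R n), [/\ measurable F, left_stable i F,
    (mu (E `\` F) <= d%:E)%E & (mu (F `\` E) <= d%:E)%E].
Proof.
move=> muT.
have sub2 (C X Y : set (Rn R n)) (d : R) : measurable C -> measurable X -> measurable Y ->
    C `<=` X `|` Y -> (mu X <= (d / 2)%:E)%E -> (mu Y <= (d / 2)%:E)%E -> (mu C <= d%:E)%E.
  move=> mC mX mY CXY Xd Yd; apply: (@le_trans _ _ (mu (X `|` Y))).
    by apply: le_measure; rewrite ?inE//; exact: measurableU.
  apply: le_trans (measureU2 _ mX mY) _; rewrite [d in X in (_ <= X)%E]splitr EFinD.
  exact: leeD.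
apply: box_induction => [a b _ d d0|E G mE mG _ HE HG d d0|F mF ndF HF d d0].
- exists (box a b); split; rewrite ?setDv ?measure0 ?lee_fin ?ltW//; first exact: measurable_box.
  exact: left_stable_box.
- have d20 : 0 < d / 2 by rewrite divr_gt0.
  have [E' [mE' sE' E1 E2]] := HE _ d20; have [G' [mG' sG' G1 G2]] := HG _ d20.
  exists (E' `\` G'); split; [exact: measurableD|exact: left_stableD| |].
  + apply: (sub2 _ (E `\` E') (G' `\` G)) => //; try (by do ?apply: measurableD).
    move=> x [[Ex nGx] nE']; have [G'x|nG'x] := pselect (G' x); first by right.
    by left; split=> // E'x; apply: nE'.
  + apply: (sub2 _ (E' `\` E) (G `\` G')) => //; try (by do ?apply: measurableD).
    move=> x [[Ex nGx] nE']; have [G'x|nG'x] := pselect (G x); first by right.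
    by left; split=> // E'x; apply: nE'.
- have d20 : 0 < d / 2 by rewrite divr_gt0.
  have mU : measurable (\bigcup_k F k) by exact: bigcupT_measurable.
  have c : mu (\bigcup_k F k `\` F l) @[l --> \oo] --> (0%:E : \bar R).
    have := @nonincreasing_cvg_mu _ _ _ mu (fun l => \bigcup_k F k `\` F l).
    rewrite (_ : \bigcap_l _ = set0) ?measure0.
      apply.
      + by apply: le_lt_trans muT; apply: le_measure; rewrite ?inE//; exact: measurableD.
      + by move=> l; exact: measurableD.
      + exact: measurable0.
      + by move=> k l kl; apply/subsetPset; apply: setDS; exact/subsetPset/ndF.
    by rewrite -subset0 => x H; have [[k _ Fk] _] := H 0%N I; have [_] := H k I.
  have [l Hl] : exists l, (mu (\bigcup_k F k `\` F l) < (d / 2)%:E)%E.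
    have : \forall l \near \oo, (mu (\bigcup_k F k `\` F l) < (d / 2)%:E)%E.
      apply: (c [set y | (y < (d / 2)%:E)%E]); apply: open_nbhs_nbhs; split.
        exact: open_ereal_lt_ereal.
      by rewrite /= lte_fin.
    by move=> [N _ HN]; exists N; exact: HN (leqnn N).
  have [G [mG sG G1 G2]] := HF l _ d20.
  exists G; split => //.
  + apply: (sub2 _ (\bigcup_k F k `\` F l) (F l `\` G)) => //; try (by do ?apply: measurableD).
      move=> x [Fx nG]; have [Fl|nFl] := pselect (F l x); first by right.
      by left.
    exact: ltW.
  + apply: (@le_trans _ _ (mu (G `\` F l))).
      apply: le_measure; rewrite ?inE; try exact: measurableD.
      by move=> x [Gx nF]; split=> // Fl; apply: nF; exists l.
    by apply: le_trans G2 _; rewrite lee_fin; lra.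
Qed.

(** * Sets of large increments are null *)

Section increment_bound.
Variables (R : realType) (n : nat) (lam : {measure set (Rn R n) -> \bar R}).
Hypothesis Hlam : is_lebesgue_measure lam.
Variables (Omega : set (Rn R n)) (f fa : Rn R n -> R)
  (mp mm : {measure set (Rn R n) -> \bar R}) (i : 'I_n).
Hypotheses (mO : measurable Omega) (Hf : lam.-integrable Omega (EFin \o f))
  (Hfa : lam.-integrable Omega (EFin \o fa))
  (Hmp : (mp Omega < +oo)%E) (Hmm : (mm Omega < +oo)%E).
Hypothesis HDf : forall phi : 'rV[R]_n -> R, test_function Omega phi ->
  Rintegral lam Omega (fun x => f x * partial i phi x) =
  - (Rintegral lam Omega (fun x => phi x * fa x) + Rintegral mp Omega phi
     - Rintegral mm Omega phi).
Variables (A B : 'rV[R]_n) (r : R).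
Hypotheses (r0 : 0 < r) (AB : forall j, A 0 j <= B 0 j)
  (QO : [set x : 'rV[R]_n | forall j, A 0 j <= x 0 j <= B 0 j + r] `<=` Omega).

Let e := evec R i.
Let Q : set (Rn R n) := box A B.
(** [Q'] contains every point from which a segment of length at most [r] in direction [- e_i] can
    reach [Q], so the averages of subsets of [Q] vanish outside it. *)
Let Q' : set (Rn R n) := box A (B + const_mx r).
Variable p : R.
Let c (x : Rn R n) : R := `|fa x - p|.

Let mQ' : measurable Q'. Proof. exact: measurable_box. Qed.

Let Q'O : Q' `<=` Omega.
Proof.
by move=> x Hx; apply: QO => j; have := Hx j; rewrite !mxE => /andP[/ltW -> ->].
Qed.

Let lamQ' : (lam Q' < +oo)%E.
Proof. by rewrite Hlam ?ltry// => j; rewrite !mxE ler_wpDr// ltW. Qed.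

Let mpQ' : (mp Q' < +oo)%E.
Proof. by apply: le_lt_trans Hmp; apply: le_measure; rewrite ?inE. Qed.

Let int_fap : lam.-integrable Q' (EFin \o (fun x => fa x - p)).
Proof.
have i1 : lam.-integrable Q' (EFin \o fa) by exact: integrableS Hfa.
have i2 : lam.-integrable Q' (EFin \o (cst p)).
  apply: measurable_bounded_integrable => //.
  by exists `|p|; split; [exact: num_real|move=> y py x _; exact: ltW].
by have := integrableB mQ' i1 i2.
Qed.

Let int_c : lam.-integrable Q' (EFin \o c).
Proof. exact: integrable_norm int_fap. Qed.

(* [c] is the modulus of the absolutely continuous part of the derivative of
   [f - p * x_i];
   the summand 1 makes the measure with this density dominate [lam]. *)
Let dens (x : Rn R n) : \bar R := ((fun x => (c x + 1)%:E) \_ Q') x.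

Let dens_ge0 x : (0 <= dens x)%E.
Proof.
rewrite /dens patchE; case: ifP => // _.
by rewrite lee_fin addr_ge0// normr_ge0.
Qed.

Let int_c1 : lam.-integrable Q' (fun x => (c x + 1)%:E).
Proof.
have i1 := integrable_one mQ' lamQ'.
by have := integrableD mQ' int_c i1.
Qed.

Let mdens : measurable_fun setT dens.
Proof.
have /integrableP[mf _] := int_c1.
exact: (measurable_restrictT (fun x => (c x + 1)%:E) mQ').1 mf.
Qed.

Let nu (X : set (Rn R n)) : \bar R := (\int[lam]_(x in X) dens x)%E.

Let nu0 : nu set0 = 0%E. Proof. by rewrite /nu integral_set0. Qed.

Let nu_ge0 X : (0 <= nu X)%E. Proof. by apply: integral_ge0 => x _. Qed.

Let nu_sigma : semi_sigma_additive nu.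
Proof. exact: semi_sigma_additive_nng_induced. Qed.

HB.instance Definition _ := isMeasure.Build _ _ _ nu nu0 nu_ge0 nu_sigma.

Let mpr : {measure set (Rn R n) -> \bar R} := mrestr mp mQ'.

(** One finite measure controls both errors: the Lebesgue mass of [S] lost outside [F], and the two
    integrals over the excess of [F] outside [S]. *)
Let mu : {measure set (Rn R n) -> \bar R} := measure_add (nu : {measure set _ -> \bar R}) mpr.

Let muE X : mu X = (nu X + mp (X `&` Q'))%E.
Proof. exact: (measure_addE (nu : {measure set _ -> \bar R}) mpr X). Qed.

Let nuE X : measurable X -> nu X = (\int[lam]_(x in X `&` Q') (c x + 1)%:E)%E.
Proof. by move=> mX; rewrite /nu integral_mkcondr. Qed.

Let mu_fin : (mu setT < +oo)%E.
Proof.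
rewrite muE nuE// !setTI lte_add_pinfty//.
exact: integral_fune_lt_pinfty.
Qed.

Let lam_le_nu X : measurable X -> X `<=` Q' -> (lam X <= nu X)%E.
Proof.
move=> mX XQ; rewrite nuE// setIidl// -[leLHS]mul1e -integral_cst//.
have /integrableP[mc _] := int_c1.
apply: ge0_le_integral => //.
- by apply: measurable_funS mc.
- by move=> x _; rewrite lee_fin lerDr normr_ge0.
Qed.

Variables (q : R) (h_ : nat -> R) (S : set (Rn R n)).
Hypotheses (pq : p < q) (h_gt0 : forall k, 0 < h_ k) (h_lt : forall k, h_ k < r)
  (h_cvg : h_ k @[k --> \oo] --> 0) (mS : measurable S) (SQ : S `<=` Q)
  (mpS : mp S = 0%E) (Sfa : forall x, S x -> fa x < p)
  (Sf : forall x k, S x -> q * h_ k <= f ((x : 'rV[R]_n) + h_ k *: e) - f x).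

Let avg_out h (E : set (Rn R n)) (x : Rn R n) : 0 <= h -> h <= r -> E `<=` Q ->
  ~ Q' x -> avg i h E x = 0.
Proof.
move=> h0 hr EQ nQ; apply: avg_eq0 => t t0 th Et; apply: nQ => j.
have := EQ _ Et j; rewrite !mxE eqxx/=.
by have := r0; case: (j == i); rewrite ?mulr1 ?mulr0 => ? /andP[? ?]; apply/andP; split; lra.
Qed.

Let Rintegral_Q' (m : {measure set (Rn R n) -> \bar R}) (phi u : Rn R n -> R) :
  (forall x, ~ Q' x -> phi x = 0) ->
  Rintegral m Omega (fun x => phi x * u x) = Rintegral m Q' (fun x => phi x * u x).
Proof.
move=> phi0; rewrite -(Rintegral_indicM m (fun x => phi x * u x) Q'O).
apply: eq_Rintegral => x _; rewrite indicE.
have [|] := boolP (x \in Q'); first by rewrite mul1r.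
by rewrite notin_setE => /phi0 ->; rewrite mul0r mulr0.
Qed.

(** Subtracting slope [p] in direction [e_i] turns [q] into [q - p] on the left and [fa] into
    [fa - p] on the right. On [S] the latter is negative and [mp] has no mass, so only the
    complement of [S] contributes to the upper bound; the [mm] term is nonpositive and is
    dropped. *)
Lemma increment_bound (E : set (Rn R n)) (k : nat) : measurable E -> E `<=` S ->
  (q - p) * fine (lam E) <=
  Rintegral lam Q' (fun x => (\1_(~` S) x * (h_ k)^-1 * avg i (h_ k) E x) * c x) +
  Rintegral mp Q' (fun x => (\1_(~` S) x * (h_ k)^-1 * avg i (h_ k) E x) * 1).
Proof.
move=> mE ES; set h := h_ k; have h0 : 0 < h := h_gt0 k; have hr : h < r := h_lt k.
have h0' := ltW h0; have hr' := ltW hr.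
have EQ : E `<=` Q by exact: subset_trans SQ.
have QQ' : Q `<=` Q'.
  move=> x Qx j; have /andP[-> xB] := Qx j; rewrite !mxE.
  by rewrite (le_trans xB)// lerDl ltW.
have EQ' : E `<=` Q' by exact: subset_trans QQ'.
have EO : E `<=` Omega by exact: subset_trans Q'O.
have [intf1 dq] := difference_quotientE Hlam mO Hf Hfa Hmp Hmm HDf AB QO h0 hr mE EQ.
set phi := avg i h E; rewrite -/phi in dq.
have phi_ge0 x : 0 <= phi x by exact: avg_ge0.
have phi_le x : phi x <= h by exact: avg_le.
have phi_norm x : `|phi x| <= h by rewrite ger0_norm.
have mphi D : measurable_fun D phi by apply: measurable_funTS; exact: measurable_avg.
have phi_out x : ~ Q' x -> phi x = 0 by exact: avg_out.
have lamE : lam E \is a fin_num.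
  rewrite ge0_fin_numE//; apply: le_lt_trans lamQ'.
  by apply: le_measure; rewrite ?inE.
have intfE : lam.-integrable E (EFin \o f) by exact: integrableS Hf.
have lhs : q * h * fine (lam E) <=
    Rintegral lam E (fun x => f ((x : 'rV[R]_n) + h *: e)) - Rintegral lam E f.
  rewrite -RintegralB//.
  have icst : lam.-integrable E (EFin \o (cst (q * h))).
    apply: measurable_bounded_integrable => //; first by rewrite -ge0_fin_numE.
    by exists `|q * h|; split; [exact: num_real|move=> y py x _; exact: ltW].
  have -> : q * h * fine (lam E) = Rintegral lam E (cst (q * h)).
    by rewrite Rintegral_cst.
  apply: le_Rintegral => //.
    by have := integrableB mE intf1 intfE.
  by move=> x Ex; apply: Sf; exact: ES.
have int1 : lam.-integrable Q' (EFin \o (fun x => phi x * (fa x - p))).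
  exact: integrableM_bounded (fun x _ => phi_norm x).
have i1 := integrable_one mQ' lamQ'.
have int2 : lam.-integrable Q' (EFin \o (fun x => phi x * 1)).
  exact: integrableM_bounded (fun x _ => phi_norm x).
have i1p := integrable_one mQ' mpQ'.
have int2p : mp.-integrable Q' (EFin \o (fun x => phi x * 1)).
  exact: integrableM_bounded (fun x _ => phi_norm x).
have phiE : Rintegral lam Q' (fun x => phi x * 1) = h * fine (lam E).
  rewrite /Rintegral -[h]/(fine h%:E) -fineM// -(integral_avg i h0' Hlam mE).
  rewrite [X in fine X]integral_mkcond; congr fine; apply: eq_integral => x _.
  rewrite patchE; case: ifPn; first by rewrite mulr1.
  by rewrite notin_setE => /phi_out; rewrite /phi => ->.
have rhs1 : Rintegral lam Omega (fun x => phi x * fa x) =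
    Rintegral lam Q' (fun x => phi x * (fa x - p)) + p * (h * fine (lam E)).
  rewrite Rintegral_Q'// -phiE -RintegralZl// -RintegralD//.
    by apply: eq_Rintegral => x _; ring.
  by have := integrableZl mQ' p int2.
pose g x := \1_(~` S) x * h^-1 * phi x.
have g_norm x : `|g x| <= 1.
  rewrite /g indicE; case: (_ \in _); last by rewrite !mul0r normr0.
  by rewrite mul1r ger0_norm ?mulr_ge0 ?invr_ge0// mulrC ler_pdivrMr// mul1r.
have mg : measurable_fun Q' g.
  apply: measurable_funM => //; apply: measurable_funM; last exact: measurable_cst.
  by apply: measurable_indicT; exact: measurableC.
have intg : lam.-integrable Q' (EFin \o (fun x => g x * c x)).
  exact: integrableM_bounded (fun x _ => g_norm x).
have intgp : mp.-integrable Q' (EFin \o (fun x => g x * 1)).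
  exact: integrableM_bounded (fun x _ => g_norm x).
have rhs2 : Rintegral lam Q' (fun x => phi x * (fa x - p)) <=
    h * Rintegral lam Q' (fun x => g x * c x).
  rewrite -RintegralZl//; apply: le_Rintegral => //.
    by have := integrableZl mQ' h intg.
  move=> x _; rewrite /g indicE.
  have -> (z : R) : h * (z * h^-1 * phi x * c x) = z * (phi x * c x).
    by field; rewrite gt_eqF.
  have [xS|] := boolP (x \in ~` S).
    by rewrite mul1r ler_wpM2l// /c ler_norm.
  rewrite notin_setE/= => /contrapT /Sfa xp; rewrite mul0r.
  by rewrite mulr_ge0_le0// subr_le0 ltW.
have rhs3 : Rintegral mp Omega (fun x => phi x * 1) = h * Rintegral mp Q' (fun x => g x * 1).
  rewrite Rintegral_Q'// -RintegralZl// /Rintegral; congr fine.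
  apply: ae_eq_integral => //.
  - by have /integrableP[] := int2p.
  - by have := integrableZl mQ' h intgp => /integrableP[].
  - exists S; split=> // x /= H; apply: contrapT => nS; apply: H => _ /=.
    rewrite /g indicE mem_set// mul1r; congr EFin.
    by field; rewrite gt_eqF.
have rhs4 : 0 <= Rintegral mm Omega (fun x => phi x * 1).
  by apply: Rintegral_ge0 => x _; rewrite mulr1.
rewrite -(ler_pM2l h0) mulrDr -rhs3.
apply: (@le_trans _ _ (q * h * fine (lam E) - p * (h * fine (lam E)))).
  by rewrite le_eqVlt; apply/orP; left; apply/eqP; ring.
by move: lhs; rewrite dq rhs1; move: rhs2 rhs4; rewrite /g; lra.
Qed.

Lemma null_increment_set : lam S = 0%E.
Proof.
have lamS : lam S \is a fin_num.
  rewrite ge0_fin_numE//; apply: le_lt_trans lamQ'.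
  apply: le_measure; rewrite ?inE//.
  move=> x /SQ Qx j; have /andP[-> xB] := Qx j; rewrite !mxE.
  by rewrite (le_trans xB)// lerDl ltW.
have SQ' : S `<=` Q'.
  move=> x /SQ Qx j; have /andP[-> xB] := Qx j; rewrite !mxE.
  by rewrite (le_trans xB)// lerDl ltW.
set s := fine (lam S).
suff s0 : s <= 0.
  by apply/eqP; rewrite -(fineK lamS) eqe eq_le s0 fine_ge0.
(* [s - d] will bound [lam E] from below, and the right-hand [d] will bound the mass of [F] outside
   [S]. If [s > 0], taking [d] to be half of [(q - p) * s / (1 + (q - p))] gives a contradiction. *)
suff H d : 0 < d -> (q - p) * (s - d) <= d.
  rewrite leNgt; apply/negP => s0.
  have qp : 0 < q - p by rewrite subr_gt0.
  have D0 : 0 < (1 + (q - p)) * 2 by rewrite mulr_gt0// addr_gt0.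
  have d0 : 0 < (q - p) * s / ((1 + (q - p)) * 2) by rewrite divr_gt0// mulr_gt0.
  have := H _ d0; set d := _ / _ in d0 *.
  have dE : (q - p) * s = d * ((1 + (q - p)) * 2) by rewrite /d divfK// gt_eqF.
  by nra.
move=> d0.
have [F [mF sF SF FS]] := approximation_left_stable i mu_fin mS d0.
pose E := S `&` F.
have mE : measurable E by exact: measurableI.
have ES : E `<=` S by exact: subIsetl.
have Ege : s - d <= fine (lam E).
  have H : (lam (S `\` F) <= d%:E)%E.
    apply: le_trans SF; rewrite muE; apply: le_trans (lam_le_nu _ _) _.
    - exact: measurableD.
    - by apply: subset_trans SQ'; exact: subDsetl.
    - by rewrite leeDl.
  have := measureDI lam mS mF; move/(congr1 fine).
  rewrite fineD; last 2 first.
  - by rewrite ge0_fin_numE//; apply: le_lt_trans H _; rewrite ltry.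
  - rewrite ge0_fin_numE//; apply: le_lt_trans (_ : lam S < _)%E; last by rewrite -ge0_fin_numE.
    by apply: le_measure; rewrite ?inE.
  have : fine (lam (S `\` F)) <= d.
    rewrite -lee_fin fineK// ge0_fin_numE//; apply: le_lt_trans H _; exact: ltry.
  by rewrite -/s -/E; lra.
have bound k := increment_bound k mE ES.
(* This dominates the weight of [increment_bound]: the weight is 0 on [S] and at most 1 on the rest
   of [F]. Off [F] the normalized average remains, and it is eventually 0 at each point. *)
pose u k x := \1_(F `\` S) x + \1_(~` F) x * ((h_ k)^-1 * avg i (h_ k) E x).
have avg_hE k x : 0 <= (h_ k)^-1 * avg i (h_ k) E x <= 1.
  apply/andP; split; first by rewrite mulr_ge0 ?avg_ge0// invr_ge0 ltW.
  by rewrite mulrC ler_pdivrMr// mul1r avg_le// ltW.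
have mavg k D : measurable_fun D (fun x => (h_ k)^-1 * avg i (h_ k) E x).
  apply: measurable_funM => //; apply: measurable_funTS; apply: measurable_avg => //.
  exact: ltW.
have mu_ k : measurable_fun Q' (u k).
  apply: measurable_funD; first by apply: measurable_indicT; exact: measurableD.
  by apply: measurable_funM => //; apply: measurable_indicT; exact: measurableC.
have ind01 (D : set (Rn R n)) x : 0 <= (\1_D x : R) <= 1.
  by rewrite indicE; case: (_ \in _); rewrite ?lexx ?ler01.
have u_norm k x : Q' x -> `|u k x| <= 1 + 1.
  move=> _; rewrite /u; have /andP[? ?] := ind01 (F `\` S) x.
  have /andP[? ?] := ind01 (~` F) x; have /andP[? ?] := avg_hE k x.
  rewrite ger0_norm; first by apply: lerD => //; rewrite mulr_ile1.
  by rewrite addr_ge0// mulr_ge0.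
have u_cvg x : Q' x -> u k x @[k --> \oo] --> (\1_(F `\` S) x : R).
  move=> _; rewrite -[X in _ --> X]addr0; apply: cvgD; first exact: cvg_cst.
  apply: cvg_near_cst; rewrite indicE.
  have [nF|] := boolP (x \in ~` F); last by move=> _; apply: nearW => k; rewrite mul0r.
  rewrite inE/= in nF; have [t0 t00 Ht] := sF x.
  have : \forall k \near \oo, h_ k < t0.
    by move/cvgr_lt : h_cvg; apply.
  (* Once [h_ k] is below the stability radius of [x], a segment ending at [x] outside [F] misses
     [F], hence also [E]. *)
  apply: filterS => k hk; rewrite avg_eq0 ?mulr0// => t tge th [_ Ft].
  by apply: nF; apply/(Ht t tge (lt_trans th hk)).
have boundu k : (q - p) * fine (lam E) <=
    Rintegral lam Q' (fun x => u k x * c x) + Rintegral mp Q' (fun x => u k x * 1).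
  apply: le_trans (bound k) _.
  have le_u x : \1_(~` S) x * (h_ k)^-1 * avg i (h_ k) E x <= u k x.
    rewrite /u -mulrA; have /andP[z0 z1] := avg_hE k x.
    set z := (h_ k)^-1 * avg i (h_ k) E x in z0 z1 *.
    rewrite !indicE in_setD !in_setC.
    by case: (x \in S); case: (x \in F); rewrite /= ?mul0r ?mul1r ?addr0 ?add0r.
  have mg : measurable_fun Q' (fun x => \1_(~` S) x * (h_ k)^-1 * avg i (h_ k) E x).
    under eq_fun do rewrite -mulrA.
    by apply: measurable_funM => //; apply: measurable_indicT; exact: measurableC.
  have g_norm x : Q' x -> `|\1_(~` S) x * (h_ k)^-1 * avg i (h_ k) E x| <= 1.
    move=> _; rewrite -mulrA; have /andP[z0 z1] := avg_hE k x.
    have /andP[t0 t1] := ind01 (~` S) x.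
    by rewrite ger0_norm; [exact: mulr_ile1|exact: mulr_ge0].
  apply: lerD; apply: le_Rintegral => //.
  - exact: integrableM_bounded g_norm.
  - exact: integrableM_bounded (u_norm k).
  - by move=> x _; rewrite ler_wpM2r// normr_ge0.
  - exact: integrableM_bounded (integrable_one mQ' mpQ') mg g_norm.
  - exact: integrableM_bounded (integrable_one mQ' mpQ') (mu_ k) (u_norm k).
  - by move=> x _; rewrite !mulr1.
have cv : Rintegral lam Q' (fun x => u k x * c x) + Rintegral mp Q' (fun x => u k x * 1)
    @[k --> \oo] --> Rintegral lam Q' (fun x => \1_(F `\` S) x * c x) +
    Rintegral mp Q' (fun x => \1_(F `\` S) x * 1).
  apply: cvgD; first exact: cvg_Rintegral_bounded u_norm u_cvg.
  exact: cvg_Rintegral_bounded (integrable_one mQ' mpQ') mu_ u_norm u_cvg.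
have lim : (q - p) * fine (lam E) <=
    Rintegral lam Q' (fun x => \1_(F `\` S) x * c x) +
    Rintegral mp Q' (fun x => \1_(F `\` S) x * 1).
  by apply: cvgr_to_ge cv _; apply: nearW => k; exact: boundu.
(* Since [c <= c + 1], the two integrals together are at most the [mu]-mass of the part of [F]
   outside [S]. *)
have lim2 : Rintegral lam Q' (fun x => \1_(F `\` S) x * c x) +
    Rintegral mp Q' (fun x => \1_(F `\` S) x * 1) <= d.
  have mFS : measurable ((F `\` S) `&` Q') by apply: measurableI => //; exact: measurableD.
  have ind x (v : R) : x \in Q' -> \1_(F `\` S) x * v = \1_((F `\` S) `&` Q') x * v.
    by move=> xQ; rewrite !indicE in_setI xQ andbT.
  have indE (m : {measure set (Rn R n) -> \bar R}) (v : Rn R n -> R) :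
      Rintegral m Q' (fun x => \1_(F `\` S) x * v x) =
      Rintegral m Q' (fun x => \1_((F `\` S) `&` Q') x * v x).
    by apply: eq_Rintegral => x /ind ->.
  rewrite !indE.
  rewrite !Rintegral_indicM; try exact: subIsetr.
  rewrite Rintegral_cst// mul1r -lee_fin EFinD.
  have mpfin : mp ((F `\` S) `&` Q') \is a fin_num.
    rewrite ge0_fin_numE//; apply: le_lt_trans mpQ'.
    by apply: le_measure; rewrite ?inE//; exact: subIsetr.
  rewrite [X in (_ + X <= _)%E]fineK//; apply: le_trans FS; rewrite muE leeD2r//.
  rewrite nuE; last exact: measurableD.
  have ic : lam.-integrable ((F `\` S) `&` Q') (EFin \o c).
    by apply: integrableS int_c => //; exact: subIsetr.
  rewrite /Rintegral fineK; last exact: integrable_fin_num.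
  have /integrableP[mc _] := ic.
  apply: ge0_le_integral => //.
  - by move=> x _; rewrite lee_fin normr_ge0.
  - have /integrableP[mc1 _] := int_c1.
    by apply: measurable_funS mc1 => //; exact: subIsetr.
  - by move=> x _; rewrite lee_fin lerDl.
apply: le_trans lim2; apply: le_trans lim.
by rewrite ler_wpM2l// subr_ge0 ltW.
Qed.

End increment_bound.

(** * Conclusion *)

(** Negation exchanges positive and negative parts; infinite values fit the formula since [fine]
    sends both infinities to 0. *)
Lemma RintegralN d (T : measurableType d) (R : realType)
    (mu : {measure set T -> \bar R}) (D : set T) (u : T -> R) :
  Rintegral mu D (fun x => - u x) = - Rintegral mu D u.
Proof.
have fineB (a b : \bar R) : fine (b - a) = - fine (a - b).
  by case: a b => [a||] [b||] //=; rewrite ?oppr0 ?opprB.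
rewrite /Rintegral integralE [X in _ = - fine X]integralE -fineB; congr fine.
have -> : (fun x => (- u x)%:E) = (\- (fun x => (u x)%:E))%E by [].
by rewrite funeposN funenegN.
Qed.

Lemma negligible_bigcup_countable d (T : measurableType d) (R : realType)
    (mu : {measure set T -> \bar R}) (I : countType) (G : I -> set T) :
  (forall w, mu.-negligible (G w)) -> mu.-negligible (\bigcup_w G w).
Proof.
move=> negG; apply: (@negligibleS _ _ _ _
  (\bigcup_k (if (unpickle k : option I) is Some w then G w else set0))).
  by move=> x [w _ Gx]; exists (pickle w) => //; rewrite pickleK.
by apply: negligible_bigcup => k; case: unpickle => // ; exact: negligible_set0.
Qed.

Section partial_derivative.
Variables (R : realType) (n : nat) (lam : {measure set (Rn R n) -> \bar R}).
Hypothesis Hlam : is_lebesgue_measure lam.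
Variables (Omega : set (Rn R n)) (f fa g : Rn R n -> R)
  (mp mm : {measure set (Rn R n) -> \bar R}) (i : 'I_n) (N Z : set (Rn R n)).
Hypotheses (oO : open (Omega : set 'rV[R]_n)) (Hf : lam.-integrable Omega (EFin \o f))
  (Hfa : lam.-integrable Omega (EFin \o fa))
  (Hmp : (mp Omega < +oo)%E) (Hmm : (mm Omega < +oo)%E).
Hypothesis HDf : forall phi : 'rV[R]_n -> R, test_function Omega phi ->
  Rintegral lam Omega (fun x => f x * partial i phi x) =
  - (Rintegral lam Omega (fun x => phi x * fa x) + Rintegral mp Omega phi
     - Rintegral mm Omega phi).
Hypotheses (mN : measurable N) (lamN : lam N = 0%E) (mpN : mp (Omega `\` N) = 0%E)
  (mZ : measurable Z) (lamZ : lam Z = 0%E)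
  (gf : forall x, Omega x -> ~ Z x -> g x = f x).

Let e := evec R i.
Let h_ (k : nat) : R := k.+1%:R^-1.
Let mO : measurable Omega. Proof. exact: sub_sigma_algebra. Qed.

(** The condition uses [f], which is measurable on [Omega], instead of [g], and countably many
    steps, so that the set is measurable. The index [m] is the point of the sequence after which all
    quotients are large. *)
Definition increment_set (a b : 'rV[R]_n) (p q : R) (m : nat) : set (Rn R n) :=
  [set x | [/\ box a b x, ~ N x, fa x < p &
    forall k, q * h_ (k + m) <= f ((x : 'rV[R]_n) + h_ (k + m) *: e) - f x]].

(** [h_ l] plays the part of the margin [r], and [l < m] puts every step strictly below it. *)
Lemma increment_set_null (a b : 'rV[R]_n) (p q : R) (l m : nat) :
  (forall j, a 0 j <= b 0 j) -> p < q -> (l < m)%N ->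
  [set x : 'rV[R]_n | forall j, a 0 j <= x 0 j <= b 0 j + h_ l] `<=` Omega ->
  measurable (increment_set a b p q m) /\ lam (increment_set a b p q m) = 0%E.
Proof.
move=> ab pq lm QO.
have hl0 k : 0 < h_ k by rewrite /h_ invr_gt0 ltr0n.
have hlt k : h_ (k + m) < h_ l.
  by rewrite /h_ ltf_pV2 ?posrE ?ltr0n// ltr_nat ltnS (leq_trans lm)// leq_addl.
have QO' t : 0 <= t -> t <= h_ l -> forall x, box a b x -> Omega (x + t *: e).
  move=> t0 tl x Hx; apply: QO => j; have := Hx j; rewrite !mxE eqxx/=.
  by case: (j == i); rewrite ?mulr1 ?mulr0 => /andP[? ?]; apply/andP; split; lra.
have boxO : box a b `<=` Omega.
  by move=> x Hx; have := QO' 0 (lexx 0) (ltW (hl0 l)) x Hx; rewrite scale0r addr0.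
have mbox : measurable (box a b : set (Rn R n)) by exact: measurable_box.
have mf : measurable_fun Omega f by have /integrableP[/measurable_EFinP] := Hf.
have mfa : measurable_fun Omega fa by have /integrableP[/measurable_EFinP] := Hfa.
have mS : measurable (increment_set a b p q m).
  pose In k : set (Rn R n) := box a b `&`
    (fun x => f ((x : 'rV[R]_n) + h_ (k + m) *: e) - f x) @^-1` `[q * h_ (k + m), +oo[%classic.
  rewrite (_ : increment_set _ _ _ _ _ =
      (box a b `&` ~` N) `&` ((Omega `&` fa @^-1` `]-oo, p[%classic) `&` \bigcap_k In k)).
    apply: measurableI; first by apply: measurableI => //; exact: measurableC.
    apply: measurableI; first by apply: mfa => //; exact: measurable_itv.
    apply: bigcapT_measurable => k.
    have mI : measurable_fun (box a b : set (Rn R n))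
        (fun x => f ((x : 'rV[R]_n) + h_ (k + m) *: e) - f x).
      apply: measurable_funB; last exact: measurable_funS mf.
      apply: (measurable_comp mO _ mf).
        by move=> _ [x Hx <-]; apply: QO' => //; exact: ltW.
      by apply: measurable_funTS; exact: measurable_translation.
    by apply: mI => //; exact: measurable_itv.
  apply/seteqP; split=> x /=.
    move=> [Hx Nx fx H]; split=> //; split; first by split; [exact: boxO|rewrite in_itv].
    by move=> k _; split=> //=; rewrite in_itv/= andbT.
  move=> [[Hx Nx] [[_]]]; rewrite in_itv/= => fx H; split=> // k.
  by have [_ /=] := H k I; rewrite in_itv/= andbT.
split=> //.
apply: (null_increment_set Hlam mO Hf Hfa Hmp Hmm HDf (hl0 l) ab QO pq
  (h_ := fun k => h_ (k + m))) => //.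
- rewrite /h_; have := @cvg_harmonic R.
  by rewrite -(cvg_shiftn m); apply.
- by move=> x [].
(* The set avoids [N], and [mp] has no mass in [Omega] outside [N]. *)
- apply/eqP; rewrite eq_le measure_ge0 andbT -mpN; apply: le_measure; rewrite ?inE//.
    exact: measurableD.
  by move=> x [Hx Nx _ _]; split=> //; exact: boxO.
- by move=> x [].
- by move=> x k [].
Qed.

Lemma negligible_partial_gt :
  lam.-negligible [set x | [/\ Omega x, derivable (g : 'rV[R]_n -> R) x e & fa x < partial i g x]].
Proof.
(* Countable parameters: the two corners of a rational box, the rationals [p < q], and the indices
   [l] of the margin and [m] of the threshold. *)
pose idx : Type := ('rV[rat]_n * 'rV[rat]_n) * (rat * rat) * (nat * nat).
pose good (w : idx) := [/\ forall j, (map_mx ratr w.1.1.1 : 'rV[R]_n) 0 j <= map_mx ratr w.1.1.2 0 j,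
  (ratr w.1.2.1 : R) < ratr w.1.2.2, (w.2.1 < w.2.2)%N &
  [set x : 'rV[R]_n | forall j, (map_mx ratr w.1.1.1 : 'rV[R]_n) 0 j <= x 0 j <=
     (map_mx ratr w.1.1.2 : 'rV[R]_n) 0 j + h_ w.2.1] `<=` Omega].
pose G (w : idx) : set (Rn R n) := [set x | good w /\
  increment_set (map_mx ratr w.1.1.1) (map_mx ratr w.1.1.2)
    (ratr w.1.2.1) (ratr w.1.2.2) w.2.2 x].
have negG : lam.-negligible (\bigcup_w G w).
  apply: negligible_bigcup_countable => w.
  have [[w1 w2 w3 w4]|bad] := pselect (good w); last first.
    by apply: negligibleS (negligible_set0 _) => x [].
  have [mS S0] := increment_set_null w1 w2 w3 w4.
  exists (increment_set (map_mx ratr w.1.1.1) (map_mx ratr w.1.1.2)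
       (ratr w.1.2.1) (ratr w.1.2.2) w.2.2); split=> //.
  by move=> x [].
(* Outside these translates and [Z] itself, [g] agrees with [f] at both ends of every increment that
   stays in [Omega]. *)
have negZ : lam.-negligible (\bigcup_k [set x : Rn R n | Z ((x : 'rV[R]_n) + h_ k *: e)]).
  apply: negligible_bigcup => k; exists [set x : Rn R n | Z ((x : 'rV[R]_n) + h_ k *: e)].
  by split=> //; [exact: measurable_translate|rewrite lebesgue_translate].
have negN : lam.-negligible (N `|` Z).
  by apply: negligibleU; [exists N; split|exists Z; split].
apply: negligibleS (negligibleU negN (negligibleU negZ negG)).
move=> x [Ox dx lt_x].
have [|/not_orP[Nx Zx]] := pselect ((N `|` Z) x); first by left.
right; have [|nZ] := pselect ((\bigcup_k [set x : Rn R n | Z ((x : 'rV[R]_n) + h_ k *: e)]) x).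
  by left.
right.
have [p] := rat_in_itvoo lt_x; rewrite in_itv/= => /andP[fap pD].
have [q] := rat_in_itvoo pD; rewrite in_itv/= => /andP[pq qD].
have [[a b] [r [r0 xab ab abO]]] := open_rat_box oO Ox.
have h_cvg : h_ k @[k --> \oo] --> (0 : R) by exact: cvg_harmonic.
have [l _ /(_ l (leqnn l)) hlr] : \forall l \near \oo, h_ l < r.
  by move/cvgr_lt : h_cvg; apply.
have abO' : [set y : 'rV[R]_n | forall j, (map_mx ratr a : 'rV[R]_n) 0 j <= y 0 j <=
     (map_mx ratr b : 'rV[R]_n) 0 j + h_ l] `<=` Omega.
  move=> y Hy; apply: abO => j; have /andP[-> yb] := Hy j.
  by rewrite (le_trans yb)// lerD2l ltW.
have quot : (fun k => (h_ k)^-1 * (g (h_ k *: e + x) - g x)) @ \oo --> partial i g x.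
  have cd : (fun h : R => h^-1 *: ((g \o shift x) (h *: e) - g x)) @ 0^' --> partial i g x.
    exact: dx.
  apply: (cvg_comp h_ _ _ cd) => /=.
  have := h_cvg; move=> H U [d d0 dU].
  have [K _ HK] := H _ (nbhsx_ballx (0 : R) d d0).
  exists K => // k /= kK; apply: dU; first exact: (HK k kK).
  by rewrite /h_ invr_neq0.
have [m0 _ Hm0] : \forall k \near \oo, (ratr q : R) < (h_ k)^-1 * (g (h_ k *: e + x) - g x).
  by move/cvgr_gt : quot; apply.
(* Large enough for the quotients to exceed [q] and for the steps to stay strictly below the margin
   [h_ l]. *)
pose m := maxn m0 l.+1.
pose w : idx := ((a, b), (p, q), (l, m)).
have gw : good w by split => //=; rewrite /m leq_max leqnn orbT.
exists w => //; split=> //; split => //= k.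
have hk0 : 0 < h_ (k + m) by rewrite /h_ invr_gt0.
have := Hm0 (k + m)%N; rewrite /= (leq_trans (leq_maxl m0 l.+1))// ?leq_addl// => /(_ isT).
have hkl : h_ (k + m) <= h_ l.
  rewrite /h_ lef_pV2 ?posrE ?ltr0n// ler_nat ltnS.
  by rewrite (leq_trans (leqnSn l))// (leq_trans (leq_maxr m0 l.+1))// leq_addl.
have Oxh : Omega (x + h_ (k + m) *: e).
  apply: abO' => j; have := xab j; rewrite !mxE eqxx/=; move: hk0 hkl.
  by case: (j == i); rewrite ?mulr1 ?mulr0 => ? ? /andP[? ?]; apply/andP; split; lra.
rewrite [_ *: e + x]addrC (gf Ox Zx) (gf Oxh); last by move=> Zxh; apply: nZ; exists (k + m)%N.
by rewrite mulrC ltr_pdivlMr// => /ltW.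
Qed.

End partial_derivative.

Unset Implicit Arguments.

Theorem theorem9p3p8 (R : realType) (n : nat)
  (lam : {measure set (Rn R n) -> \bar R})
  (Hlam : is_lebesgue_measure lam)
  (Omega : set 'rV[R]_n) (HOopen : open Omega) (HOne : Omega !=set0)
  (f : 'rV[R]_n -> R)
  (Hf : lam.-integrable (Omega : set (Rn R n)) (fun x => (f x)%:E))
  (fa : 'I_n -> 'rV[R]_n -> R)
  (Hfa : forall j, lam.-integrable (Omega : set (Rn R n)) (fun x => (fa j x)%:E))
  (Dsp Dsm : 'I_n -> {measure set (Rn R n) -> \bar R})
  (HDsfin : forall j, (Dsp j Omega < +oo)%E /\ (Dsm j Omega < +oo)%E)
  (HDssing : exists N : set (Rn R n), measurable N /\ lam N = 0%E /\
     forall j, Dsp j (Omega `\` N) = 0%E /\ Dsm j (Omega `\` N) = 0%E)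
  (HDf : forall (j : 'I_n) (phi : 'rV[R]_n -> R), test_function Omega phi ->
     Rintegral lam (Omega : set (Rn R n)) (fun x => f x * partial j phi x) =
     - (Rintegral lam (Omega : set (Rn R n)) (fun x => phi x * fa j x)
        + Rintegral (Dsp j) (Omega : set (Rn R n)) phi
        - Rintegral (Dsm j) (Omega : set (Rn R n)) phi))
  (i : 'I_n) (g : 'rV[R]_n -> R)
  (Hgf : {ae lam, forall x : Rn R n, Omega x -> g x = f x})
  (Hgd : {ae lam, forall x : Rn R n, Omega x -> derivable g x (evec R i)}) :
  {ae lam, forall x : Rn R n, Omega x -> partial i g x = fa i x}.
Proof.
have [Z [mZ lamZ HZ]] := Hgf.
have gf x : Omega x -> ~ Z x -> g x = f x.
  by move=> Ox nZ; apply: contrapT => gfx; apply: nZ; apply: HZ => /(_ Ox).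
have [N [mN [lamN /(_ i)[mpN mmN]]]] := HDssing.
have [Hmp Hmm] := HDsfin i.
have gt : lam.-negligible
    [set x | [/\ Omega x, derivable g x (evec R i) & fa i x < partial i g x]].
  exact: (negligible_partial_gt Hlam HOopen Hf (Hfa i) Hmp Hmm (HDf i)
    mN lamN mpN mZ lamZ gf).
have lt : lam.-negligible
    [set x | [/\ Omega x, derivable (fun y => - g y) x (evec R i) &
      - fa i x < partial i (fun y => - g y) x]].
  (* Negating [f] exchanges the positive and negative singular parts, hence [Dsm i] comes before
     [Dsp i]. *)
  apply: (@negligible_partial_gt _ _ _ Hlam Omega (fun y => - f y) (fun y => - fa i y)
    (fun y => - g y) (Dsm i) (Dsp i) i N Z HOopen) => //.
  - by have := integrableN Hf.
  - by have := integrableN (Hfa i).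
  - move=> phi tphi.
    have -> : Rintegral lam Omega (fun x => - f x * partial i phi x) =
        - Rintegral lam Omega (fun x => f x * partial i phi x).
      by rewrite -RintegralN; apply: eq_Rintegral => x _; rewrite mulNr.
    have -> : Rintegral lam Omega (fun x => phi x * - fa i x) =
        - Rintegral lam Omega (fun x => phi x * fa i x).
      by rewrite -RintegralN; apply: eq_Rintegral => x _; rewrite mulrN.
    by rewrite HDf//; ring.
  - by move=> x Ox nZ; rewrite gf.
apply: negligibleS (negligibleU Hgd (negligibleU gt lt)) => x /= H.
have [dx|ndx] := pselect (Omega x -> derivable g x (evec R i)); last by left.
right; have /not_implyP[Ox /eqP neq] := H.
have {}dx := dx Ox.
move: neq; rewrite neq_lt => /orP[ltx|gtx]; [right|left] => //.
have dN : derivable (fun y => - g y) x (evec R i) by exact: derivableN.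
split=> //; have -> : partial i (fun y => - g y) x = - partial i g x by exact: deriveN.
by rewrite ltrN2.
Qed.
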